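(* Let $\mathbb{K}$ be an algebraically closed field. Let $B$ be a $\mathbb{K}$-algebra with a $\mathbb{K}$-automorphism $\alpha$ such that $B[y^{\pm 1};\alpha]$ is simple and $Z(B[y^{\pm 1};\alpha])=\mathbb{K}$. Let $t\geq 0$ be an integer and let $A$ be the polynomial algebra $B[c_1,\dots,c_t]$ in $t$ algebraically independent commuting indeterminates. Extend $\alpha$ to a $\mathbb{K}$-automorphism of $A$ by setting $\alpha(c_i)=c_i$ for $1\leq i\leq t$. Let $u\in A$ be central, let $v=u-\alpha(u)$ and, in the conformal ambiskew polynomial ring $R=R(A,\alpha,v,1)$, let $z$ be the Casimir element $xy-u$. Then: (i) $Z(A[y^{\pm 1};\alpha])=\mathbb{K}[c_1,\dots,c_t]$ and $Z(R)$ is the polynomial algebra $\mathbb{K}[z,c_1,\dots,c_t]$. (ii) Let $\mathcal{Z}=Z(R)\setminus\{0\}$. The localization $R_{\mathcal{Z}}$ is simple if and only if, for all $m\geq 1$, there exists a non-zero polynomial $p_m(X,X_1,\dots,X_t)\in \mathbb{K}[X,X_1,\dots,X_t]$ such that $p_m(u,c_1,\dots,c_t)\in v^{(m)}A$, where $v^{(m)}=u-\alpha^m(u)$.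
   Context: Rings are associative with $1$; $Z(\cdot)$ denotes the centre. For a $\mathbb{K}$-algebra $A$, a $\mathbb{K}$-automorphism $\alpha$ of $A$ and a central element $v\in A$, the ambiskew polynomial algebra $R(A,\alpha,v,1)$ is the iterated skew polynomial ring $A[y;\alpha][x;\beta,\delta]$, where $\beta=\alpha^{-1}$ on $A$, $\beta(y)=y$, and $\delta$ is the $\beta$-derivation of $A[y;\alpha]$ with $\delta(A)=0$ and $\delta(y)=v$. Thus $ya=\alpha(a)y$ and $xa=\alpha^{-1}(a)x$ for all $a\in A$, and $xy=yx+v$. When $v=u-\alpha(u)$ with $u$ central in $A$, the ring is called conformal and the Casimir element $z=xy-u$ is central in $R$. The rings $A[y^{\pm 1};\alpha]$ and $B[y^{\pm 1};\alpha]$ are skew Laurent polynomial rings with $ya=\alpha(a)y$. *)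

(* Defs.v *)
From mathcomp Require Import all_boot all_order all_algebra.
From mathcomp Require Import finmap mpoly.
Set Implicit Arguments.
Unset Strict Implicit.
Unset Printing Implicit Defensive.
Import GRing.Theory.
Local Open Scope ring_scope.

(* Skew polynomial rings, skew Laurent rings, ambiskew polynomial rings and     *)
(* central localizations are specified, up to unique isomorphism over the       *)
(* base ring, by their standard internal definitions: a ring containing the     *)
(* base ring (through an embedding i), with the prescribed basis and relations. *)

Definition central (R : nzRingType) (r : R) : Prop := forall s, r * s = s * r.

Record two_sided_ideal (R : nzRingType) (I : R -> Prop) : Prop :=
  TwoSidedIdeal {
    ideal_0 : I 0;
    ideal_D : forall a b, I a -> I b -> I (a + b);
    ideal_Ml : forall r a, I a -> I (r * a);
    ideal_Mr : forall r a, I a -> I (a * r) }.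

(* Nonzeroness of R is part of nzRingType. *)
Definition simple_ring (R : nzRingType) : Prop :=
  forall I : R -> Prop, two_sided_ideal I ->
    (forall a, I a -> a = 0) \/ (forall a, I a).

(* S is a free left A-module (A acting through i) with basis e: each element    *)
(* of S is \sum_k i (a k) * e k for exactly one finitely supported family a.    *)
Definition free_left_basis (A S : nzRingType) (i : A -> S)
    (I : choiceType) (e : I -> S) : Prop :=
  bijective (fun a : {fsfun I -> A with 0} =>
               \sum_(k <- finsupp a) i (a k) * e k).

(* d is a left s-derivation. *)
Record skew_derivation (A : nzRingType) (s d : A -> A) : Prop :=
  SkewDerivation {
    skew_derD : forall a b, d (a + b) = d a + d b;
    skew_derM : forall a b, d (a * b) = s a * d b + d a * b }.

(* S = A[x; s, d], with x a = s(a) x + d(a). *)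
Record is_skew_poly (A : nzRingType) (s : {rmorphism A -> A}) (d : A -> A)
    (S : nzRingType) (i : {rmorphism A -> S}) (x : S) : Prop :=
  IsSkewPoly {
    skew_poly_der : skew_derivation s d;
    skew_poly_comm : forall a, x * i a = i (s a) * x + i (d a);
    skew_poly_basis : free_left_basis i (fun n : nat => x ^+ n) }.

(* S = A[y^{+-1}; s], with y a = s(a) y. *)
Record is_skew_laurent (A : nzRingType) (s : {rmorphism A -> A})
    (S : unitRingType) (i : {rmorphism A -> S}) (y : S) : Prop :=
  IsSkewLaurent {
    skew_laurent_unit : y \is a GRing.unit;
    skew_laurent_comm : forall a, y * i a = i (s a) * y;
    skew_laurent_basis : free_left_basis i (fun n : int => y ^ n) }.

(* R = R(A, s, v, 1) = A[y; s][x; b, d], the intermediate ring A[y; s] being T  *)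
(* with variable y0 and inclusions j : A -> T and k : T -> R.  The equation     *)
(* b (j (s a)) = j a expresses that b is s^-1 on A.                             *)
Definition is_ambiskew (A : nzRingType) (s : {rmorphism A -> A}) (v : A)
    (R : nzRingType) (i : {rmorphism A -> R}) (x y : R) : Prop :=
  exists (T : nzRingType) (j : {rmorphism A -> T}) (y0 : T)
         (b : {rmorphism T -> T}) (d : T -> T) (k : {rmorphism T -> R}),
    [/\ is_skew_poly s (fun=> 0) j y0,
        (forall a, b (j (s a)) = j a) /\ b y0 = y0,
        (forall a, d (j a) = 0) /\ d y0 = j v,
        is_skew_poly b d k x
      & (forall a, i a = k (j a)) /\ y = k y0].

(* L is the ring of fractions of R with respect to the set Z, intended for a    *)
(* multiplicatively closed set of central elements.                             *)
Record is_localization (R : nzRingType) (Z : R -> Prop)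
    (L : unitRingType) (f : {rmorphism R -> L}) : Prop :=
  IsLocalization {
    loc_unit : forall s, Z s -> f s \is a GRing.unit;
    loc_frac : forall l, exists r s, Z s /\ l = f r / f s;
    loc_ker : forall r, f r = 0 <-> exists2 s, Z s & r * s = 0 }.

Definition nonzero_central (R : nzRingType) (r : R) : Prop :=
  central r /\ r <> 0.

(* p(w, c_1, ..., c_t) computed in a ring S over B[c_1, ..., c_t] (through i),  *)
(* for p in K[X, X_1, ..., X_t] and B a K-algebra; X is the variable of index   *)
(* ord0, X_j the one of index lift ord0 j.                                      *)
Definition eval_wc (K : fieldType) (B : algType K) (t : nat) (S : nzRingType)
    (i : {mpoly B[t]} -> S) (w : S) (p : {mpoly K[t.+1]}) : S :=
  mmap (fun k : K => i (k%:A)%:MP)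
       (fun m : 'I_t.+1 => if unlift ord0 m is Some j then i 'X_j else w) p.

(* Main.v *)
Require Import Defs.
From HB Require Import structures.
From mathcomp Require Import all_boot all_order all_algebra.
From mathcomp Require Import finmap mpoly.
From Stdlib Require Import Classical IndefiniteDescription.
Set Implicit Arguments.
Unset Strict Implicit.
Unset Printing Implicit Defensive.
Import GRing.Theory.
Local Open Scope ring_scope.

(** Write S = B[y^{+-1}; alpha], M = S[c_1, ..., c_t] and N = M[z].  Sending x to
    (z + u) y^-1 embeds R in N, with the Casimir element going to z, and every
    element of N lands in R after multiplication by a power of y.  Since S is
    simple with centre K, every nonzero ideal of N meets its centre
    K[z, c_1, ..., c_t]; hence every nonzero ideal of R contains q y^n for some
    nonzero central q.  Multiplying q y^n by x on either side gives q (z + u) y^(n-1)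
    and q (z + alpha^n(u)) y^(n-1), and as p_n(-z, c) is congruent to p_n(u, c)
    modulo z + u, also q p_n(-z, c) y^(n-1): by descent on n the ideal meets the
    centre.  Conversely, the elements of R that map a Verma module into the
    submodule of vectors whose coordinates 0, ..., m-1 are multiples of v^(m) form
    an ideal containing y^m; a central q(z, c) in it acts on the vector e_0 as
    q(-u, c), which is therefore a multiple of v^(m). *)

(** * Free left bases and expansions in skew polynomial rings *)

Lemma in_fset_seq (I : choiceType) (s : seq I) (k : I) :
  (k \in [fset l in s]%fset) = (k \in s).
Proof. by rewrite !inE. Qed.

Lemma free_left_basis_span (A S : nzRingType) (i : {rmorphism A -> S})
    (I : choiceType) (e : I -> S) :
  free_left_basis i e ->
  forall r, exists (s : seq I) (a : I -> A),
    uniq s /\ r = \sum_(k <- s) i (a k) * e k.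
Proof.
move=> [c _ cK] r; exists (finsupp (c r)), (c r).
by split; [exact: fset_uniq | rewrite cK].
Qed.

(** Cutting [a] off outside [s] gives a finitely supported family with zero sum, and injectivity of
    the basis map identifies it with the zero family. *)
Lemma free_left_basis_indep (A S : nzRingType) (i : {rmorphism A -> S})
    (I : choiceType) (e : I -> S) :
  free_left_basis i e ->
  forall (s : seq I) (a : I -> A), uniq s ->
    \sum_(k <- s) i (a k) * e k = 0 -> forall k, k \in s -> a k = 0.
Proof.
move=> bij_e s a uniq_s sum0 k ks.
pose g : {fsfun I -> A with 0} := [fsfun l in [fset l in s]%fset => a l | 0].
have gE l : l \in s -> g l = a l by rewrite fsfunE in_fset_seq => ->.
have g_sub l : l \notin s -> g l = 0 by rewrite fsfunE in_fset_seq => /negPf ->.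
have gsum : \sum_(l <- finsupp g) i (g l) * e l = 0.
  have sumE : \sum_(l <- s) i (a l) * e l =
      \sum_(l <- s | l \in finsupp g) i (g l) * e l.
    rewrite [RHS]big_mkcond; apply: eq_big_seq => l ls.
    rewrite mem_finsupp gE //; case: eqP => //= ->.
    by rewrite rmorph0 mul0r.
  rewrite -[RHS]sum0 sumE -[RHS]big_filter; apply/perm_big/uniq_perm.
  - exact: fset_uniq.
  - exact: filter_uniq.
  move=> l; rewrite mem_filter.
  case ls: (l \in s); rewrite ?andbT ?andbF //.
  by rewrite mem_finsupp g_sub ?ls // eqxx.
have g0 : g = [fsfun].
  apply: (bij_inj bij_e); rewrite gsum.
  by rewrite big1_seq // => l /=; rewrite mem_finsupp fsfun0E eqxx.
by rewrite -gE // g0 fsfun0E.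
Qed.

Section SkewPolyExpansion.
Variables (A S : nzRingType) (i : {rmorphism A -> S}) (x : S).
Hypothesis basis_x : free_left_basis i (fun n : nat => x ^+ n).

(** Over a noncommutative ring, Horner evaluation keeps the coefficients to the left of the powers
    of [x], so ordinary polynomials over [A] serve as coordinates on [S]. *)
Lemma skew_poly_expand r : exists p : {poly A}, (map_poly i p).[x] = r.
Proof.
have [s [a [_ ->]]] := free_left_basis_span basis_x r.
exists (\sum_(k <- s) (a k)%:P * 'X^k).
rewrite rmorph_sum horner_sum; apply: eq_bigr => k _.
by rewrite rmorphM /= map_polyC map_polyXn hornerCM hornerXn.
Qed.

Lemma skew_poly_expand_inj : injective (fun p : {poly A} => (map_poly i p).[x]).
Proof.
suff ker0 p : (map_poly i p).[x] = 0 -> p = 0.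
  by move=> p q /eqP; rewrite -subr_eq0 -hornerN -hornerD -rmorphB;
     move=> /eqP/ker0/eqP; rewrite subr_eq0 => /eqP.
rewrite (horner_coef_wide _ (size_poly _ _)) => p0.
apply/polyP => k; rewrite coef0.
have [kp|/leq_sizeP-> //] := ltnP k (size p).
apply: (free_left_basis_indep basis_x (iota_uniq 0 (size p)));
  last by rewrite mem_iota.
have -> : iota 0 (size p) = index_iota 0 (size p) by rewrite /index_iota subn0.
rewrite -[RHS]p0 big_mkord.
by apply: eq_bigr => l _; rewrite coef_map.
Qed.

End SkewPolyExpansion.

Section SkewPolyInduction.
Variables (A S : nzRingType) (s : {rmorphism A -> A}) (d : A -> A).
Variables (i : {rmorphism A -> S}) (x : S).

Lemma skew_poly_ind (P : S -> Prop) : is_skew_poly s d i x ->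
  P 0 -> (forall r a, P r -> P (r * x + i a)) -> forall r, P r.
Proof.
move=> skewS P0 Px r.
have [p <-] := skew_poly_expand (skew_poly_basis skewS) r.
elim/poly_ind: p => [|p c IHp]; first by rewrite rmorph0 horner0.
by rewrite rmorphD rmorphM /= map_polyX map_polyC hornerD hornerMX hornerC; apply: Px.
Qed.

End SkewPolyInduction.

(** * Actions of skew polynomial rings *)

(** Module structures are kept as bare maps because one additive group successively receives actions
    of [A], of A[y; s] and of [R]. *)
Record is_action (A : nzRingType) (V : zmodType) (rho : A -> V -> V) : Prop :=
  IsAction {
    actDl : forall a b v, rho (a + b) v = rho a v + rho b v;
    actDr : forall a v w, rho a (v + w) = rho a v + rho a w;
    actM : forall a b v, rho (a * b) v = rho a (rho b v);
    act1 : forall v, rho 1 v = v }.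

Lemma additive_map0 (V : zmodType) (f : V -> V) : {morph f : v w / v + w} -> f 0 = 0.
Proof. by move=> fD; apply: (addrI (f 0)); rewrite -fD !addr0. Qed.

Lemma act0l (A : nzRingType) (V : zmodType) (rho : A -> V -> V) v :
  is_action rho -> rho 0 v = 0.
Proof. by move=> rhoA; apply: (addrI (rho 0 v)); rewrite -(actDl rhoA) !addr0. Qed.

Lemma act0r (A : nzRingType) (V : zmodType) (rho : A -> V -> V) a :
  is_action rho -> rho a 0 = 0.
Proof. by move=> rhoA; apply/additive_map0/(actDr rhoA). Qed.

Section SkewPolyAction.
Variables (A S : nzRingType) (s : {rmorphism A -> A}) (d : A -> A).
Variables (i : {rmorphism A -> S}) (x : S).
Hypothesis skewS : is_skew_poly s d i x.
Variables (V : zmodType) (rho : A -> V -> V) (X : V -> V).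
Hypothesis rhoA : is_action rho.
Hypothesis XD : {morph X : v w / v + w}.
Hypothesis Xrho : forall a v, X (rho a v) = rho (s a) (X v) + rho (d a) v.

Let act (p : {poly A}) v := \sum_(k < size p) rho p`_k (iter k X v).

Let act_wide n (p : {poly A}) v : (size p <= n)%N ->
  act p v = \sum_(k < n) rho p`_k (iter k X v).
Proof.
move=> pn; rewrite /act (big_ord_widen n (fun k => rho p`_k (iter k X v)) pn).
rewrite big_mkcond; apply: eq_bigr => k _; case: ltnP => // /leq_sizeP-> //.
by rewrite act0l.
Qed.

Let act_polyD p q v : act (p + q) v = act p v + act q v.
Proof.
pose n := maxn (size p) (size q).
rewrite !(act_wide (n := n)) ?leq_maxl ?leq_maxr ?size_polyD //.
by rewrite -big_split; apply: eq_bigr => k _; rewrite coefD (actDl rhoA).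
Qed.

Let act_polyMX p v : act (p * 'X) v = act p (X v).
Proof.
rewrite (act_wide (n := (size p).+1)); last first.
  by rewrite (leq_trans (size_polyMleq _ _)) // size_polyX addn2.
rewrite big_ord_recl coefMX /= act0l // add0r; apply: eq_bigr => k _.
by rewrite coefMX /= -iterS iterSr.
Qed.

Let act_polyC c v : act c%:P v = rho c v.
Proof. by rewrite (act_wide _ (size_polyC_leq1 c)) big_ord1 coefC. Qed.

(** The element \sum_k a_k x^k acts as \sum_k a_k X^k; the hypothesis [Xrho] is the relation x a =
    s(a) x + d(a) read on [V]. *)
Lemma skew_poly_action : exists rho' : S -> V -> V,
  [/\ is_action rho', (forall a v, rho' (i a) v = rho a v)
    & forall v, rho' x v = X v].
Proof.
have basis_x := skew_poly_basis skewS.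
have [c cE] := functional_choice _ (skew_poly_expand basis_x).
have inj_ev := skew_poly_expand_inj basis_x.
have cD r r' : c (r + r') = c r + c r'.
  by apply: inj_ev => /=; rewrite rmorphD hornerD !cE.
have cMX r : c (r * x) = c r * 'X.
  by apply: inj_ev => /=; rewrite rmorphM /= map_polyX hornerMX !cE.
have ci a : c (i a) = a%:P.
  by apply: inj_ev => /=; rewrite map_polyC hornerC cE.
pose rho' r v := act (c r) v.
have rhoDl r r' v : rho' (r + r') v = rho' r v + rho' r' v.
  by rewrite /rho' cD act_polyD.
have rhoMx r v : rho' (r * x) v = rho' r (X v) by rewrite /rho' cMX act_polyMX.
have rhoi a v : rho' (i a) v = rho a v by rewrite /rho' ci act_polyC.
have rho0 v : rho' 0 v = 0.
  by apply: (addrI (rho' 0 v)); rewrite -rhoDl !addr0.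
have rhoDr r v w : rho' r (v + w) = rho' r v + rho' r w.
  move: r v w; apply: (skew_poly_ind skewS) => [|r a IHr] v w;
    first by rewrite !rho0 addr0.
  by rewrite !rhoDl !rhoMx !rhoi XD IHr (actDr rhoA) addrACA.
(* Multiplicativity is first obtained for left factors from [A] and for [x], where [Xrho] enters;
   Horner induction on the left factor then gives it in general. *)
have rhoiM a r v : rho' (i a * r) v = rho a (rho' r v).
  move: r v; apply: (skew_poly_ind skewS) => [|r b IHr] v.
    by rewrite mulr0 rho0 act0r.
  rewrite mulrDr mulrA -rmorphM !rhoDl !rhoMx !rhoi IHr.
  by rewrite (actM rhoA) (actDr rhoA).
have rhoxM r v : rho' (x * r) v = X (rho' r v).
  move: r v; apply: (skew_poly_ind skewS) => [|r b IHr] v.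
    by rewrite mulr0 rho0 additive_map0.
  rewrite mulrDr mulrA (skew_poly_comm skewS) !rhoDl !rhoMx !rhoi IHr XD.
  by rewrite Xrho.
exists rho'; split=> // [|v]; last first.
  by rewrite -[x]mul1r -(rmorph1 i) rhoMx rhoi (act1 rhoA).
split=> // [r r' v|v]; last by rewrite -(rmorph1 i) rhoi (act1 rhoA).
move: r r' v; apply: (skew_poly_ind skewS) => [|r b IHr] r' v.
  by rewrite mul0r !rho0.
by rewrite mulrDl -mulrA !rhoDl rhoMx rhoi IHr rhoxM rhoiM.
Qed.

End SkewPolyAction.

(** * The universal property of ambiskew polynomial rings *)

Section Ambiskew.
Variables (A : nzRingType) (s : {rmorphism A -> A}) (v : A).
Variables (R : nzRingType) (i : {rmorphism A -> R}) (x y : R).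
Hypothesis ambiR : is_ambiskew s v i x y.

Lemma ambiskew_rel :
  [/\ forall a, y * i a = i (s a) * y, forall a, x * i (s a) = i a * x
    & x * y = y * x + i v].
Proof.
case: ambiR => T [j [y0 [b [d [k [skewT [bj by0] [dj dy0] skewR [iE ->]]]]]]].
split=> [a|a|].
- by rewrite !iE -!rmorphM (skew_poly_comm skewT) rmorph0 addr0.
- by rewrite !iE (skew_poly_comm skewR) bj dj rmorph0 addr0.
- by rewrite (skew_poly_comm skewR) by0 dy0 iE.
Qed.

Lemma ambiskew_ind (P : R -> Prop) :
  (forall a, P (i a)) -> P x -> P y -> (forall r r', P r -> P r' -> P (r + r')) ->
  (forall r r', P r -> P r' -> P (r * r')) -> forall r, P r.
Proof.
case: ambiR => T [j [y0 [b [d [k [skewT _ _ skewR [iE ->]]]]]]] Pi Px Py PD PM.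
have P0 : P 0 by rewrite -(rmorph0 i).
apply: (skew_poly_ind skewR) => // r a Pr; apply: (PD); first exact: (PM).
move: a; apply: (skew_poly_ind skewT) => [|a c Pa]; first by rewrite rmorph0.
by rewrite rmorphD rmorphM -iE; apply: PD => //; apply: PM.
Qed.

Hypothesis s_surj : forall a, exists a', s a' = a.

Section Action.
Variables (V : zmodType) (rho : A -> V -> V) (X Y : V -> V).
Hypotheses (rhoA : is_action rho) (XD : {morph X : f g / f + g})
  (YD : {morph Y : f g / f + g}).
Hypothesis Yrho : forall a f, Y (rho a f) = rho (s a) (Y f).
Hypothesis Xrho : forall a f, X (rho (s a) f) = rho a (X f).
Hypothesis XY : forall f, X (Y f) = Y (X f) + rho v f.

(** The action is extended to A[y; s], then to [R]. The relation between [X] and a general element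
    of A[y; s] follows by Horner induction; surjectivity of [s] lets each coefficient be written
    [s c'], where the value of [b] is prescribed. *)
Lemma ambiskew_action : exists rhoR : R -> V -> V,
  [/\ is_action rhoR, forall a f, rhoR (i a) f = rho a f,
      forall f, rhoR x f = X f & forall f, rhoR y f = Y f].
Proof.
case: ambiR => T [j [y0 [b [d [k [skewT [bj by0] [dj dy0] skewR [iE ->]]]]]]].
have [a f|rhoT [rhoTA rhoTj rhoTy]] := skew_poly_action skewT rhoA YD.
  by rewrite Yrho act0l // addr0.
have dD := skew_derD (skew_poly_der skewR).
have d0 : d 0 = 0 by apply: (addrI (d 0)); rewrite -dD !addr0.
have [|rhoR [rhoRA rhoRk rhoRx]] := skew_poly_action skewR rhoTA XD.
  apply: (skew_poly_ind skewT) => [|a c IHa] f.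
    by rewrite d0 rmorph0 !(act0l _ rhoTA) addr0 additive_map0.
  have [c' <-] := s_surj c.
  rewrite dD (skew_derM (skew_poly_der skewR)) dj addr0 dy0 rmorphD rmorphM /= by0 bj.
  rewrite !(actDl rhoTA) !(actM rhoTA) !rhoTj !rhoTy XD IHa Xrho XY (actDr rhoTA).
  by rewrite -!addrA; congr (_ + _); rewrite [RHS]addrC -!addrA; congr (_ + _).
exists rhoR; split=> // [a f|f]; first by rewrite iE rhoRk rhoTj.
by rewrite rhoRk rhoTy.
Qed.

End Action.

(** [R] acts on [N], its generators acting by left multiplication. Such operators commute with right
    multiplications, so each [r] acts as left multiplication by [rhoR r 1], and [r] is sent to that
    element. *)
Lemma ambiskew_hom (N : nzRingType) (g : {rmorphism A -> N}) (X Y : N) :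
  (forall a, Y * g a = g (s a) * Y) -> (forall a, X * g (s a) = g a * X) ->
  X * Y = Y * X + g v ->
  exists G : {rmorphism R -> N}, [/\ forall a, G (i a) = g a, G x = X & G y = Y].
Proof.
move=> Yg Xg XYg.
have [||||||rhoR [rhoRA rhoRi rhoRx rhoRy]] :=
  @ambiskew_action N (fun a f => g a * f) ( *%R X) ( *%R Y).
- split=> *; rewrite ?rmorphD ?rmorphM ?rmorph1 ?mul1r ?mulrDl ?mulrDr ?mulrA //.
- exact: mulrDr.
- exact: mulrDr.
- by move=> a f; rewrite !mulrA Yg.
- by move=> a f; rewrite !mulrA Xg.
- by move=> f; rewrite !mulrA -mulrDl XYg.
have rhoE r f : rhoR r f = rhoR r 1 * f.
  move: r f; apply: ambiskew_ind => [a|||r r' IHr IHr'|r r' IHr IHr'] f.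
  - by rewrite !rhoRi mulr1.
  - by rewrite !rhoRx mulr1.
  - by rewrite !rhoRy mulr1.
  - by rewrite !(actDl rhoRA) IHr IHr' mulrDl.
  - by rewrite !(actM rhoRA) IHr IHr' [in RHS]IHr mulrA.
pose G r := rhoR r 1.
have GB : zmod_morphism G.
  move=> r r'; apply: (addIr (G r')); rewrite /G -(actDl rhoRA) !subrK //.
have GM : monoid_morphism G.
  by split=> [|r r']; rewrite /G ?(act1 rhoRA) // (actM rhoRA) rhoE.
pose zG := GRing.isZmodMorphism.Build _ _ G GB.
pose mG := GRing.isMonoidMorphism.Build _ _ G GM.
pose G' : {rmorphism R -> N} := HB.pack G zG mG.
by exists G'; split=> [a||]; rewrite /= /G ?rhoRi ?rhoRx ?rhoRy mulr1.
Qed.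

End Ambiskew.

(** * Ideals of polynomial rings and their central elements *)

Section CentralPolynomials.
Variable S : nzRingType.

Lemma mcoeffMC (n : nat) (f : {mpoly S[n]}) c m : (f * c%:MP)@_m = f@_m * c.
Proof.
rewrite [in LHS](mpolyE f) [in RHS](mpolyE f) mulr_suml !raddf_sum /= mulr_suml;
  apply: eq_bigr => k _.
rewrite -scalerAl -commr_mpolyX mul_mpolyC !mcoeffZ mcoeffX.
by rewrite -!mulrA commr_nat.
Qed.

Lemma central_mpoly (n : nat) (f : {mpoly S[n]}) :
  (forall c, f * c%:MP = c%:MP * f) -> central f.
Proof.
move=> fC g; rewrite (mpolyE g) mulr_sumr mulr_suml; apply: eq_bigr => m _.
by rewrite -mul_mpolyC mulrA fC -!mulrA commr_mpolyX.
Qed.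

Lemma central_poly (f : {poly S}) : (forall c, f * c%:P = c%:P * f) -> central f.
Proof.
move=> fC; elim/poly_ind=> [|p c IHp]; first by rewrite mulr0 mul0r.
by rewrite mulrDr mulrDl fC mulrA IHp -!mulrA commr_polyX.
Qed.

(** This property climbs from the simple ring [SB] to its polynomial rings; for [R] it is equivalent
    to simplicity of the central localization. *)
Definition ideals_meet_center : Prop :=
  forall (J : S -> Prop) f, two_sided_ideal J -> J f -> f <> 0 ->
  exists2 c, J c & nonzero_central c.

End CentralPolynomials.

Lemma ideal_N (R : nzRingType) (J : R -> Prop) a : two_sided_ideal J -> J a -> J (- a).
Proof. by move=> idJ Ja; rewrite -mulN1r; apply: ideal_Ml. Qed.

Lemma ideal_B (R : nzRingType) (J : R -> Prop) a b :
  two_sided_ideal J -> J a -> J b -> J (a - b).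
Proof. by move=> idJ Ja Jb; apply: ideal_D => //; apply: ideal_N. Qed.

(* An element of minimal support, normalized to have a coefficient 1, commutes   *)
(* with the constants: a commutator has smaller support.                         *)
Lemma mpoly_ideals_meet_center (S : nzRingType) n :
  simple_ring S -> ideals_meet_center {mpoly S[n]}.
Proof.
move=> simpleS J f idJ.
have [N] := ubnP (size (msupp f)); elim: N f => // N IHN f fN Jf f0.
pose m := mlead f; have mf : m \in msupp f by apply: mlead_supp; apply/eqP.
(* The coefficients at [m] of the elements of [J] supported within [f] form a nonzero ideal of [S],
   hence all of [S]; this gives [g] with coefficient 1 at [m], so that its commutators with
   constants lose the monomial [m]. *)
pose I s := exists g, [/\ J g, {subset msupp g <= msupp f} & g@_m = s].
have idI : two_sided_ideal I.
  split.
  - by exists 0; rewrite mcoeff0; split=> //; [exact: ideal_0 | rewrite msupp0].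
  - move=> _ _ [g [Jg gf <-]] [h [Jh hf <-]]; exists (g + h); rewrite mcoeffD.
    split=> //; first exact: ideal_D.
    by move=> k /msuppD_le; rewrite mem_cat => /orP[/gf|/hf].
  - move=> r _ [g [Jg gf <-]]; exists (r%:MP * g); rewrite mcoeffCM.
    split=> //; first exact: ideal_Ml.
    by move=> k; rewrite mul_mpolyC => /msuppZ_le /gf.
  move=> r _ [g [Jg gf <-]]; exists (g * r%:MP); rewrite mcoeffMC.
  split=> //; first exact: ideal_Mr.
  move=> k; rewrite mcoeff_msupp mcoeffMC => gk; apply: gf.
  by rewrite mcoeff_msupp; apply: contraNneq gk => ->; rewrite mul0r.
have [g [Jg gf g1]] : I 1.
  case: (simpleS I idI) => [I0|//]; move: mf; rewrite mcoeff_msupp.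
  by rewrite (I0 f@_m) ?eqxx; last by exists f; split.
pose h s := g * s%:MP - s%:MP * g.
have Jh s : J (h s) by apply: ideal_B => //; [apply: ideal_Mr | apply: ideal_Ml].
have hE s k : (h s)@_k = g@_k * s - s * g@_k by rewrite mcoeffB mcoeffMC mcoeffCM.
have hN s : (size (msupp (h s)) < N)%N.
  apply: leq_ltn_trans (_ : size (rem m (msupp f)) < N)%N; last first.
    by rewrite size_rem // -ltnS prednK //; case: (msupp f) mf.
  apply: uniq_leq_size => // k; rewrite mem_rem_uniq //= !inE mcoeff_msupp hE.
  case: (eqVneq k m) => [->|_] /=; first by rewrite g1 mul1r mulr1 subrr eqxx.
  move=> hk; apply: gf; rewrite mcoeff_msupp; apply: contraNneq hk => ->.
  by rewrite mul0r mulr0 subrr.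
have [[s hs]|h0] := classic (exists s, h s <> 0); first exact: IHN hs.
exists g => //; split; last by move=> g0; move/eqP: g1;
  rewrite g0 mcoeff0 eq_sym oner_eq0.
apply: central_mpoly => s; apply/eqP; rewrite -subr_eq0; apply/eqP.
by apply: NNPP => hs; apply: h0; exists s.
Qed.

(* Same argument with the degree in place of the support. *)
Lemma poly_ideals_meet_center (S : nzRingType) :
  ideals_meet_center S -> ideals_meet_center {poly S}.
Proof.
move=> meetS J f idJ.
have [N] := ubnP (size f); elim: N f => // N IHN f fN Jf f0.
have f_gt0 : (0 < size f)%N by rewrite lt0n size_poly_eq0; apply/eqP.
(* The coefficients in degree [n] form a nonzero ideal of [S]. It contains a nonzero central
   element, which replaces the coefficient 1 of the previous argument. *)
pose n := (size f).-1; pose I s := exists g, [/\ J g, (size g <= size f)%N & g`_n = s].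
have idI : two_sided_ideal I.
  split.
  - by exists 0; rewrite coef0 size_poly0; split=> //; exact: ideal_0.
  - move=> _ _ [g [Jg gf <-]] [h [Jh hf <-]]; exists (g + h); rewrite coefD.
    split=> //; first exact: ideal_D.
    by rewrite (leq_trans (size_polyD _ _)) // geq_max gf.
  - move=> r _ [g [Jg gf <-]]; exists (r%:P * g); rewrite coefCM.
    split=> //; first exact: ideal_Ml.
    by apply/leq_sizeP => k kf; rewrite coefCM nth_default ?mulr0 // (leq_trans gf).
  move=> r _ [g [Jg gf <-]]; exists (g * r%:P); rewrite coefMC.
  split=> //; first exact: ideal_Mr.
  by apply/leq_sizeP => k kf; rewrite coefMC nth_default ?mul0r // (leq_trans gf).
have [||_ [g [Jg gf <-]] [gC /eqP g0]] := meetS I f`_n idI.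
- by exists f.
- by apply/eqP; rewrite -/(lead_coef f) lead_coef_eq0; apply/eqP.
pose h s := g * s%:P - s%:P * g.
have Jh s : J (h s) by apply: ideal_B => //; [apply: ideal_Mr | apply: ideal_Ml].
have hN s : (size (h s) < N)%N.
  rewrite (@leq_ltn_trans n) //; last by rewrite /n; case: (size f) f_gt0 fN.
  apply/leq_sizeP => k nk; rewrite coefB coefMC coefCM.
  case: (ltngtP n k) nk => // [nk|<-] _; last by rewrite gC subrr.
  by rewrite nth_default ?mul0r ?mulr0 ?subrr // (leq_trans gf) // -(prednK f_gt0).
have [[s hs]|h0] := classic (exists s, h s <> 0); first exact: IHN hs.
exists g => //; split; last by move=> gz; move: g0; rewrite gz coef0 eqxx.
apply: central_poly => s; apply/eqP; rewrite -subr_eq0; apply/eqP.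
by apply: NNPP => hs; apply: h0; exists s.
Qed.

(** * Skew Laurent rings *)

Section SkewLaurent.
Variables (A : nzRingType) (s : {rmorphism A -> A}).
Variables (S : unitRingType) (i : {rmorphism A -> S}) (y : S).
Hypothesis laurS : is_skew_laurent s i y.

Lemma skew_laurent_ind (P : S -> Prop) :
  (forall a, P (i a)) -> P y -> P y^-1 ->
  (forall r r', P r -> P r' -> P (r + r')) ->
  (forall r r', P r -> P r' -> P (r * r')) -> forall r, P r.
Proof.
move=> Pi Py PV PD PM r.
have [l [a [_ ->]]] := free_left_basis_span (skew_laurent_basis laurS) r.
have PX w n : P w -> P (w ^+ n).
  by move=> Pw; elim: n => [|n IHn]; [rewrite expr0 -(rmorph1 i) | rewrite exprS;
    apply: (PM)].
elim/big_rec: _ => [|k w _ Pw]; first by rewrite -(rmorph0 i).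
apply: (PD) => //; apply: (PM) => //; case: k => n; first by rewrite -exprnP; apply: PX.
by rewrite NegzE -exprnN -exprVn; apply: PX.
Qed.

Lemma skew_laurent_indep (p : {poly A}) : (map_poly i p).[y] = 0 -> p = 0.
Proof.
rewrite (horner_coef_wide _ (size_poly _ _)) => p0; apply/polyP => k; rewrite coef0.
have [kp|/leq_sizeP-> //] := ltnP k (size p).
pose l := [seq Posz n | n <- iota 0 (size p)].
have uniq_l : uniq l by rewrite map_inj_uniq ?iota_uniq // => m n [].
have lk : Posz k \in l by rewrite map_f // mem_iota.
apply: (free_left_basis_indep (skew_laurent_basis laurS)
  (a := fun z => p`_`|z|%N) uniq_l _ lk).
rewrite big_map -[RHS]p0.
have -> : iota 0 (size p) = index_iota 0 (size p) by rewrite /index_iota subn0.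
by rewrite big_mkord; apply: eq_bigr => n _; rewrite coef_map /= -exprnP.
Qed.

Lemma skew_laurent_inj : injective i.
Proof.
move=> a b ab; apply/eqP; rewrite -subr_eq0 -polyC_eq0; apply/eqP/skew_laurent_indep.
by rewrite map_polyC hornerC /= rmorphB ab subrr.
Qed.

Lemma skew_laurent_central w :
  (forall a, w * i a = i a * w) -> w * y = y * w -> central w.
Proof.
move=> wi wy; apply: skew_laurent_ind => // [|r r' wr wr'|r r' wr wr'].
- exact: commrV.
- exact: commrD.
- exact: commrM.
Qed.

End SkewLaurent.

(** When [g] is inverse to [f], this is the integer power f^k; [Negz n] encodes -(n+1), whence the
    [n.+1]. *)
Definition int_iter (T : Type) (f g : T -> T) (k : int) : T -> T :=
  if k is Negz n then iter n.+1 g else iter `|k|%N f.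

(** The map [i] is a bare function so that it can also be the inclusion of the constants of B in
    A[y^{+-1}; alpha]. *)
Lemma exprz_int_iter (A : Type) (S : unitRingType) (i : A -> S) (f g : A -> A) (y : S) :
  y \is a GRing.unit -> cancel g f -> (forall a, y * i a = i (f a) * y) ->
  forall (k : int) a, y ^ k * i a = i (int_iter f g k a) * y ^ k.
Proof.
move=> Uy gK yi [n|n] a.
  rewrite -exprnP /=; elim: n a => [|n IHn] a; first by rewrite expr0 mul1r mulr1.
  by rewrite [in LHS]exprSr -mulrA yi mulrA IHn -mulrA -exprSr -iterSr.
rewrite (_ : int_iter f g (Negz n) a = iter n.+1 g a) // NegzE -exprnN -exprVn.
move: n.+1 => {}n.
elim: n a => [|n IHn] a; first by rewrite expr0 mul1r mulr1.
have yVi b : y^-1 * i b = i (g b) * y^-1.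
  by apply: (mulrI Uy); rewrite mulrA divrr // mul1r mulrA yi gK mulrK.
by rewrite [in LHS]exprSr -mulrA yVi mulrA IHn -mulrA -exprSr -iterSr.
Qed.

Lemma map_mpoly_lift (R S : nzRingType) (f : {rmorphism R -> S}) n (p : {mpoly S[n]}) :
  (forall m, exists c, p@_m = f c) -> exists q, p = map_mpoly f q.
Proof.
move=> /functional_choice[c cE]; exists (\sum_(m <- msupp p) c m *: 'X_[m]).
rewrite raddf_sum [LHS]mpolyE; apply: eq_bigr => m _.
by rewrite /= map_mpolyZ map_mpolyX cE.
Qed.

Lemma map_poly_lift (R S : nzRingType) (f : {rmorphism R -> S}) (p : {poly S}) :
  (forall k, exists c, p`_k = f c) -> exists q, p = map_poly f q.
Proof.
move=> /functional_choice[c cE]; exists (\poly_(k < size p) c k).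
apply/polyP=> k; rewrite coef_map coef_poly; case: ltnP => [_|pk]; first exact: cE.
by rewrite nth_default ?raddf0.
Qed.

(** * The centre of A[y^{+-1}; alpha] *)

Section LaurentCenter.
Variables (K : fieldType) (B : algType K) (alpha : {lrmorphism B -> B}).
Hypothesis alpha_bij : bijective alpha.
Variables (SB : unitRingType) (iB : {rmorphism B -> SB}) (yB : SB).
Hypothesis SB_laurent : is_skew_laurent alpha iB yB.
Hypothesis SB_center : forall s : SB, central s -> exists k : K, s = iB k%:A.
Variable t : nat.

Lemma scalar_mpoly_central (q : {mpoly K[t]}) : central (map_mpoly (in_alg B) q).
Proof.
apply: central_mpoly => c; apply/mpolyP => m; rewrite mcoeffMC mcoeffCM.
by rewrite mcoeff_map_mpoly /= mulr_algl mulr_algr.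
Qed.

Lemma scalar_mpoly_fixed (q : {mpoly K[t]}) :
  map_mpoly alpha (map_mpoly (in_alg B) q) = map_mpoly (in_alg B) q.
Proof.
by apply/mpolyP => m; rewrite !mcoeff_map_mpoly /= linearZ rmorph1.
Qed.

Variables (SA : unitRingType) (iA : {rmorphism {mpoly B[t]} -> SA}) (yA : SA).
Hypothesis SA_laurent : is_skew_laurent (map_mpoly alpha) iA yA.

(** Let \sum_k a_k y^k be central. Commuting with y gives alpha(a_k) = a_k, and commuting with b in
    B gives a_k alpha^k(b) = b a_k. Hence, for each coefficient b_m of a_k, the element b_m y^k is
    central in B[y^{+-1}; alpha], so it is a scalar; this forces b_m to be a scalar if k = 0 and to
    vanish otherwise. *)
Lemma laurent_center (s : SA) :
  central s <-> exists q : {mpoly K[t]}, s = iA (map_mpoly (in_alg B) q).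
Proof.
have [beta alphaK betaK] := alpha_bij.
split=> [|[q ->]]; last first.
  apply: (skew_laurent_central SA_laurent) => [a|].
    by rewrite -!rmorphM scalar_mpoly_central.
  by rewrite (skew_laurent_comm SA_laurent) /= scalar_mpoly_fixed.
have [l [a [uniq_l ->]]] := free_left_basis_span (skew_laurent_basis SA_laurent) s.
set w := \sum_(k <- l) _ => wC.
have UA := skew_laurent_unit SA_laurent; have UB := skew_laurent_unit SB_laurent.
have indepA := free_left_basis_indep (skew_laurent_basis SA_laurent).
have indepB := free_left_basis_indep (skew_laurent_basis SB_laurent).
have fixa k : k \in l -> map_mpoly alpha (a k) = a k.
  move=> kl; apply/eqP; rewrite -subr_eq0; apply/eqP.
  move: k kl; apply: (indepA l (fun k => map_mpoly alpha (a k) - a k)) => //.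
  under eq_bigr => k _ do rewrite rmorphB mulrBl.
  rewrite sumrB; apply: (mulIr UA); rewrite mul0r mulrBl -/w wC.
  apply/eqP; rewrite subr_eq0; apply/eqP; rewrite /w mulr_sumr mulr_suml.
  apply: eq_bigr => k _; rewrite mulrA (skew_laurent_comm SA_laurent) -!mulrA.
  by congr (_ * _); apply/esym/commrXz.
pose tau := int_iter alpha beta.
have commA k b : yA ^ k * iA b%:MP = iA (tau k b)%:MP * yA ^ k.
  apply: (exprz_int_iter (i := iA \o @mpolyC t B)) => //= c.
  by rewrite (skew_laurent_comm SA_laurent) /= map_mpolyC.
have commB k b : yB ^ k * iB b = iB (tau k b) * yB ^ k.
  exact/exprz_int_iter/(skew_laurent_comm SB_laurent).
have twist k b : k \in l -> a k * (tau k b)%:MP = b%:MP * a k.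
  move=> kl; apply/eqP; rewrite -subr_eq0; apply/eqP.
  move: k kl; apply: (indepA l (fun k => a k * (tau k b)%:MP - b%:MP * a k)) => //.
  under eq_bigr => k _ do rewrite rmorphB !rmorphM mulrBl -!mulrA -commA.
  rewrite sumrB -mulr_sumr -/w -wC mulr_suml -sumrB big1 // => k _.
  by rewrite mulrA subrr.
have coefC k m : k \in l -> exists c : K, iB (a k)@_m * yB ^ k = iB c%:A.
  move=> kl; apply: SB_center; apply: (skew_laurent_central SB_laurent) => [b|].
    rewrite -mulrA commB mulrA -rmorphM -mcoeffMC twist // mcoeffCM.
    by rewrite rmorphM mulrA.
  rewrite mulrA (skew_laurent_comm SB_laurent) /=.
  have -> : alpha (a k)@_m = (a k)@_m by rewrite -[in RHS](fixa k kl) mcoeff_map_mpoly.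
  rewrite -!mulrA.
  by congr (_ * _); apply/esym/commrXz.
have scalar k : k \in l -> exists q : {mpoly K[t]},
    iA (a k) * yA ^ k = iA (map_mpoly (in_alg B) q).
  move=> kl; have [k0|k0] := eqVneq k 0.
    have [m|q ->] := map_mpoly_lift (f := in_alg B) (p := a k).
      have [c] := coefC k m kl; rewrite k0 expr0z mulr1.
      by move=> /(skew_laurent_inj SB_laurent) cE; exists c.
    by exists q; rewrite k0 expr0z mulr1.
  exists 0; suff -> : a k = 0 by rewrite !rmorph0 mul0r.
  apply/mpolyP => m; rewrite mcoeff0; have [c cE] := coefC k m kl.
  (* For nonzero [k], the equality of (a_k)_m y^k with the scalar c y^0 is a linear relation between
     two distinct basis elements. *)
  have := indepB [:: k; 0] (fun j => if j == k then (a k)@_m else - c%:A).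
  rewrite !big_cons big_nil eqxx eq_sym (negPf k0) cE rmorphN expr0z mulr1 addr0 subrr.
  move=> /(_ _ erefl k); rewrite eqxx; apply; last by rewrite mem_head.
  by rewrite /= inE k0.
rewrite /w big_seq; elim/big_rec: _ => [|k v kl [q ->]]; first by exists 0;
  rewrite !rmorph0.
by have [q' ->] := scalar k kl; exists (q' + q); rewrite !rmorphD.
Qed.

End LaurentCenter.

(** * The embedding of R in N *)

Section Conjugation.
Variables (N : nzRingType) (X a Y V : N).

Lemma mulr_conj b : Y * V = 1 -> Y * X = X * Y -> Y * a = b * Y ->
  Y * ((X + a) * V) = X + b.
Proof. by move=> YV YX Ya; rewrite mulrA mulrDr YX Ya -mulrDl -mulrA YV mulr1. Qed.

Lemma mulr_twist c c' : V * c' = c * V -> X * c = c * X -> a * c = c * a ->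
  (X + a) * V * c' = c * ((X + a) * V).
Proof. by move=> Vc Xc ac; rewrite -mulrA Vc mulrA mulrDl Xc ac -mulrDr mulrA. Qed.

End Conjugation.

Section Embedding.
Variables (K : fieldType) (B : algType K) (alpha : {lrmorphism B -> B}).
Hypothesis alpha_bij : bijective alpha.
Variables (SB : unitRingType) (iB : {rmorphism B -> SB}) (yB : SB).
Hypothesis SB_laurent : is_skew_laurent alpha iB yB.
Hypothesis SB_center : forall s : SB, central s <-> exists k : K, s = iB k%:A.
Variable t : nat.
Local Notation A := {mpoly B[t]}.
Local Notation M := {mpoly SB[t]}.
Local Notation N := {poly M}.
Local Notation sig := (map_mpoly alpha : {rmorphism A -> A}).
Local Notation h := (map_mpoly iB : {rmorphism A -> M}).
Variable u : A.
Hypothesis u_central : central u.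
Variables (R : nzRingType) (iR : {rmorphism A -> R}) (x y : R).
Hypothesis R_ambiskew : is_ambiskew sig (u - sig u) iR x y.
Local Notation z := (x * y - iR u).

Local Notation Y := (yB%:MP : M).
Local Notation V := (yB^-1%:MP : M).

Let UB : yB \is a GRing.unit := skew_laurent_unit SB_laurent.

Let YV : Y * V = 1. Proof. by rewrite -mpolyCM divrr. Qed.
Let VY : V * Y = 1. Proof. by rewrite -mpolyCM mulVr. Qed.

Lemma mpoly_laurent_comm (a : A) : Y * h a = h (sig a) * Y.
Proof.
apply/mpolyP => m; rewrite mcoeffCM mcoeffMC !mcoeff_map_mpoly.
by rewrite (skew_laurent_comm SB_laurent).
Qed.

Lemma map_mpoly_surj (a : A) : exists a', sig a' = a.
Proof.
have [beta _ betaK] := alpha_bij.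
have [|a' ->] := map_mpoly_lift (f := alpha) (p := a); last by exists a'.
by move=> m; exists (beta a@_m); apply/esym/betaK.
Qed.

Lemma map_mpoly_comm (a c : A) : central a -> h a * h c = h c * h a.
Proof. by move=> aC; rewrite -!rmorphM aC. Qed.

Let Xi : N := ('X + (h u)%:P) * V%:P.

Lemma embedding_exists : exists phi : {rmorphism R -> N},
  [/\ forall a, phi (iR a) = (h a)%:P, phi x = Xi & phi y = Y%:P].
Proof.
apply: (ambiskew_hom R_ambiskew map_mpoly_surj (g := polyC \o h)) => /= [a|a|].
- by rewrite -!polyCM mpoly_laurent_comm.
- apply: mulr_twist; last by rewrite -!polyCM map_mpoly_comm.
    rewrite -!polyCM -[h (sig a)]mulr1 -YV (mulrA (h _)) -mpoly_laurent_comm.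
    by rewrite !mulrA VY mul1r.
  exact/esym/commr_polyX.
- have -> : Y%:P * Xi = 'X + (h (sig u))%:P.
    apply: mulr_conj; [by rewrite -polyCM YV|exact: commr_polyX|].
    by rewrite -!polyCM mpoly_laurent_comm.
  by rewrite /Xi -mulrA -polyCM VY mulr1 rmorphB polyCB -addrA subrKC.
Qed.

Variable phi : {rmorphism R -> N}.
Hypotheses (phii : forall a, phi (iR a) = (h a)%:P) (phix : phi x = Xi)
  (phiy : phi y = Y%:P).

Lemma phi_casimir : phi z = 'X.
Proof.
by rewrite rmorphB rmorphM phii phix phiy /Xi -mulrA -polyCM VY mulr1 addrK.
Qed.

(** For each monomial in the c_j, the coefficients at that monomial form a polynomial over B
    vanishing at [yB], so independence in [SB] applies. *)
Lemma mpoly_laurent_indep (p : {poly A}) : (map_poly h p).[Y] = 0 -> p = 0.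
Proof.
rewrite (horner_coef_wide _ (size_poly _ _)) => p0; apply/polyP => k; rewrite coef0.
apply/mpolyP => m; rewrite mcoeff0.
have pm0 : map_poly (mcoeff m) p = 0.
  apply: (skew_laurent_indep SB_laurent).
  rewrite (@horner_coef_wide _ (size p)); last first.
    by apply/leq_sizeP=> l pl;
      rewrite !coef_map_id0 ?rmorph0 ?raddf0 // nth_default ?raddf0 ?rmorph0.
  have := congr1 (mcoeff m) p0; rewrite mcoeff0 raddf_sum /= => E.
  rewrite -[RHS]E; apply: eq_bigr => l _.
  rewrite !coef_map_id0 ?rmorph0 ?raddf0 // -rmorphXn /=.
  by rewrite mcoeffMC mcoeff_map_mpoly.
by have := congr1 (fun q : {poly B} => q`_k) pm0; rewrite coef_map_id0 ?coef0 ?raddf0.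
Qed.

(** A[y; alpha] embeds in the constants M, while x goes to a polynomial of degree 1 in z with
    leading coefficient y^-1. Hence the image of \sum_(l <= n) q_l x^l has the coefficient psi(q_n)
    y^-n at z^n, and this is nonzero if q_n is. *)
Lemma phi_inj : injective phi.
Proof.
suff ker0 r : phi r = 0 -> r = 0.
  move=> r r' rr'; apply/eqP; rewrite -subr_eq0; apply/eqP/ker0.
  by rewrite rmorphB rr' subrr.
case: R_ambiskew => T [j [y0 [b [d [k [skewT _ _ skewR [iE yE]]]]]]].
(* The restriction of [phi] to A[y; alpha], which takes constant values in z, read as a map to M. *)
pose psi (w : T) : M := (phi (k w))`_0.
have psiB : zmod_morphism psi by move=> w w'; rewrite /psi !rmorphB coefB.
have phik (p : {poly A}) : phi (k (map_poly j p).[y0]) = (map_poly h p).[Y]%:P.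
  elim/poly_ind: p => [|p c IHp]; first by rewrite !rmorph0 !horner0 !rmorph0.
  rewrite !rmorphD !rmorphM /= !map_polyX !map_polyC /= !hornerD !hornerMX !hornerC.
  by rewrite !rmorphD !rmorphM /= IHp -yE phiy -iE phii.
have phiT w : phi (k w) = (psi w)%:P.
  have [p <-] := skew_poly_expand (skew_poly_basis skewT) w.
  by rewrite /psi phik coefC.
have psi_inj w : psi w = 0 -> w = 0.
  have [p <-] := skew_poly_expand (skew_poly_basis skewT) w.
  rewrite /psi phik coefC /= => /mpoly_laurent_indep ->.
  by rewrite rmorph0 horner0.
have XiX n l : (n <= l)%N -> (Xi ^+ n)`_l = if l == n then V ^+ n else 0.
  elim: n l => [|n IHn] l nl; first by rewrite !expr0 coef1; case: l nl.
  rewrite exprSr /Xi mulrA mulrDr coefMC coefD coefMX coefMC.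
  case: l nl => // l nl; rewrite /= eqSS !IHn //; last exact: leqW.
  rewrite (@gtn_eqF n l.+1) // mul0r addr0; case: eqP => _; last by rewrite mul0r.
  by rewrite -exprSr.
have [q <-] := skew_poly_expand (skew_poly_basis skewR) r.
have [-> _|q0] := eqVneq q 0; first by rewrite rmorph0 horner0.
have [n qn] : exists n, size q = n.+1 by exists (size q).-1;
  rewrite prednK // lt0n size_poly_eq0.
have -> : (map_poly k q).[x] = \sum_(l < n.+1) k q`_l * x ^+ l.
  rewrite (@horner_coef_wide _ n.+1); first by apply: eq_bigr => l _; rewrite coef_map.
  by rewrite -qn; apply: size_poly.
rewrite rmorph_sum => /(congr1 (fun f : N => f`_n)).
rewrite coef_sum coef0 big_ord_recr /= big1 => [|l _]; last first.
  rewrite rmorphM rmorphXn /= phix phiT coefCM XiX ?(ltnW (ltn_ord l)) //.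
  by rewrite gtn_eqF ?mulr0.
rewrite add0r rmorphM rmorphXn /= phix phiT coefCM XiX // eqxx => qV.
have : psi q`_n = 0.
  have VYn : V ^+ n * Y ^+ n = 1.
    by rewrite -exprMn_comm ?VY ?expr1n // /GRing.comm VY YV.
  by rewrite -[psi _]mulr1 -VYn mulrA qV mul0r.
move=> /psi_inj qn0; case/eqP: q0; apply/eqP; rewrite -lead_coef_eq0.
by rewrite /lead_coef qn /= qn0.
Qed.

End Embedding.

Lemma ambiskew_embedding (K : fieldType) (B : algType K)
    (alpha : {lrmorphism B -> B}) (alpha_bij : bijective alpha)
    (SB : unitRingType) (iB : {rmorphism B -> SB}) (yB : SB)
    (SB_laurent : is_skew_laurent alpha iB yB) (t : nat)
    (u : {mpoly B[t]}) (u_central : central u)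
    (R : nzRingType) (iR : {rmorphism {mpoly B[t]} -> R}) (x y : R)
    (R_ambiskew : is_ambiskew (map_mpoly alpha) (u - map_mpoly alpha u) iR x y) :
  exists phi : {rmorphism R -> {poly {mpoly SB[t]}}},
    [/\ injective phi, forall a, phi (iR a) = (map_mpoly iB a)%:P,
        phi x = ('X + (map_mpoly iB u)%:P) * (yB^-1%:MP)%:P,
        phi y = (yB%:MP)%:P & phi (x * y - iR u) = 'X].
Proof.
have [phi [phii phix phiy]] :=
  embedding_exists alpha_bij SB_laurent u_central R_ambiskew.
exists phi; split=> //; first exact: (phi_inj SB_laurent R_ambiskew phii phix phiy).
exact: (phi_casimir SB_laurent phii phix phiy).
Qed.

(** * Polynomials in one distinguished central variable *)

Section MmapLemmas.
Variables (n : nat) (R S S' : nzRingType).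

Lemma rmorph_mmap (G : {rmorphism S -> S'}) (f : R -> S) (h : 'I_n -> S) p :
  G (mmap f h p) = mmap (G \o f) (G \o h) p.
Proof.
rewrite /mmap rmorph_sum; apply: eq_bigr => m _; rewrite rmorphM rmorph_prod.
by congr (_ * _); apply: eq_bigr => i _; rewrite rmorphXn.
Qed.

Lemma eq_mmap (f f' : R -> S) (h h' : 'I_n -> S) p :
  f =1 f' -> h =1 h' -> mmap f h p = mmap f' h' p.
Proof.
move=> ff' hh'; apply: eq_bigr => m _; rewrite ff'; congr (_ * _).
by apply: eq_bigr => i _; rewrite hh'.
Qed.

Lemma mmap_id (p : {mpoly R[n]}) : mmap (@mpolyC n R) (fun i => 'X_i) p = p.
Proof.
rewrite [RHS]mpolyE; apply: eq_bigr => m _.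
by rewrite mul_mpolyC mpolyXE_id.
Qed.

End MmapLemmas.

Section SplitVariable.
Variables (K : fieldType) (t : nat).
Local Notation P := {poly {mpoly K[t]}}.

(** The isomorphism of K[X, X_1, ..., X_t] with K[X_1, ..., X_t][X], by which evaluation at z or u
    becomes a Horner evaluation in one variable. *)
Definition split_var : {mpoly K[t.+1]} -> P :=
  mmap (polyC \o @mpolyC t K) (fun m =>
    if unlift ord0 m is Some j then ('X_j)%:P else 'X).

Lemma split_var_bij : bijective split_var.
Proof.
pose lft := mmap (@mpolyC t.+1 K) (fun j : 'I_t => 'X_(lift ord0 j) : {mpoly K[t.+1]}).
pose lftR : {rmorphism {mpoly K[t]} -> {mpoly K[t.+1]}} := lft.
have comX : commr_rmorph lftR ('X_ord0 : {mpoly K[t.+1]}) by move=> q; apply: mulrC.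
pose F := horner_morph comX; pose ER : {rmorphism {mpoly K[t.+1]} -> P} := split_var.
exists F => [p|q].
  apply: etrans (rmorph_mmap (horner_morph comX) _ _ p) _.
  rewrite -[RHS]mmap_id; apply: eq_mmap => [c|i] /=.
    by rewrite horner_morphC /= /lft mmapC.
  by case: unliftP => [j ->|->];
    rewrite ?horner_morphC ?horner_morphX //= /lft mmapX mmap1U.
have EFC c : ER (lft c) = c%:P.
  apply: etrans (rmorph_mmap ER _ _ c) _.
  rewrite -[in RHS](mmap_id c) rmorph_mmap; apply: eq_mmap => [k|j] /=.
    by rewrite /split_var mmapC.
  by rewrite /split_var mmapX mmap1U liftK.
pose FR : {rmorphism P -> {mpoly K[t.+1]}} := F.
change (ER (FR q) = q); elim/poly_ind: q => [|q c IHq]; first by rewrite !rmorph0.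
rewrite !rmorphD !rmorphM IHq /= /F horner_morphC horner_morphX /= EFC; congr (_ * _ + _).
by rewrite /= /split_var mmapX mmap1U unlift_none.
Qed.

Lemma split_var_eq0 p : (split_var p == 0) = (p == 0).
Proof.
have E0 : split_var 0 = 0 by rewrite /split_var mmap0.
by rewrite -{1}E0 (inj_eq (bij_inj split_var_bij)).
Qed.

Variables (B : algType K) (S : nzRingType) (i : {rmorphism {mpoly B[t]} -> S}) (w : S).
Hypothesis wi : forall q : {mpoly K[t]},
  w * i (map_mpoly (in_alg B) q) = i (map_mpoly (in_alg B) q) * w.

(** Commutation of [w] with the coefficients makes Horner evaluation a ring morphism, and it agrees
    with [eval_wc] on scalars and variables. *)
Lemma eval_wcE p : eval_wc i w p =
  (map_poly (fun q : {mpoly K[t]} => i (map_mpoly (in_alg B) q)) (split_var p)).[w].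
Proof.
pose g : {rmorphism {mpoly K[t]} -> S} := i \o map_mpoly (in_alg B).
have comw : commr_rmorph g w by move=> q; apply: wi.
change (eval_wc i w p = horner_morph comw (split_var p)).
rewrite /split_var (rmorph_mmap (horner_morph comw)); apply: eq_mmap => [c|m] /=.
  by rewrite horner_morphC /= map_mpolyC.
by case: unlift => [j|]; rewrite ?horner_morphX ?horner_morphC //= map_mpolyX.
Qed.

End SplitVariable.

(** * Clearing negative powers of y *)

Section SkewLaurentDenominators.
Variables (A : nzRingType) (s : {rmorphism A -> A}).
Variables (S : unitRingType) (i : {rmorphism A -> S}) (y : S).
Hypothesis laurS : is_skew_laurent s i y.

Let yn_comm n a : y ^+ n * i a = i (iter n s a) * y ^+ n.
Proof.
elim: n a => [|n IHn] a; first by rewrite expr0 mul1r mulr1.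
by rewrite exprSr -mulrA (skew_laurent_comm laurS) mulrA IHn -mulrA -exprSr -iterSr.
Qed.

Let yn_map n p : exists q, y ^+ n * (map_poly i p).[y] = (map_poly i q).[y].
Proof.
elim/poly_ind: p => [|p c [q qE]]; first by exists 0; rewrite !rmorph0 horner0 mulr0.
exists (q * 'X + (iter n s c)%:P * 'X^n).
rewrite !rmorphD !rmorphM /= !map_polyX !map_polyC map_polyXn /=.
rewrite !hornerD !hornerMX hornerCM hornerXn hornerC -qE.
by rewrite mulrDr mulrA yn_comm.
Qed.

Lemma skew_laurent_left_denominator (c : S) :
  exists n p, y ^+ n * c = (map_poly i p).[y].
Proof.
have Uy n : y ^+ n \is a GRing.unit by rewrite unitrX // (skew_laurent_unit laurS).
have [l [a [_ ->]]] := free_left_basis_span (skew_laurent_basis laurS) c.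
elim/big_rec: _ => [|k v _ [n [p pE]]].
  by exists 0%N, 0; rewrite mulr0 rmorph0 horner0.
case: k => m.
  have [q qE] := yn_map n ((a m)%:P * 'X^m); exists n, (q + p).
  rewrite rmorphD hornerD -qE -pE mulrDr; congr (y ^+ n * _ + _).
  by rewrite rmorphM /= map_polyC map_polyXn hornerCM hornerXn.
(* [Negz m] is the exponent -(m+1). Moving y^(m+1+n) past the coefficient applies [s] to it m+1+n
   times, and y^n remains. *)
have [q qE] := yn_map m.+1 p;
  exists (m.+1 + n)%N, ((iter (m.+1 + n) s (a (Negz m)))%:P * 'X^n + q).
rewrite rmorphD hornerD -qE -pE mulrDr; congr (_ + _); last by rewrite mulrA -exprD.
rewrite mulrA yn_comm NegzE -exprnN rmorphM /= map_polyC map_polyXn hornerCM hornerXn.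
by rewrite -mulrA (addnC m.+1 n) exprD mulrK.
Qed.

Lemma skew_laurent_right_denominator (c : S) :
  exists n p, c * y ^+ n = (map_poly i p).[y].
Proof.
have Uy n : y ^+ n \is a GRing.unit by rewrite unitrX // (skew_laurent_unit laurS).
have [l [a [_ ->]]] := free_left_basis_span (skew_laurent_basis laurS) c.
elim/big_rec: _ => [|k v _ [n [p pE]]].
  by exists 0%N, 0; rewrite mul0r rmorph0 horner0.
have mulXn m q : (map_poly i (q * 'X^m)).[y] = (map_poly i q).[y] * y ^+ m.
  rewrite rmorphM /= map_polyXn; elim: m => [|m IHm]; first by rewrite !expr0 !mulr1.
  by rewrite !exprSr !mulrA hornerMX IHm.
case: k => m.
  exists n, ((a m)%:P * 'X^(m + n) + p).
  by rewrite rmorphD hornerD -pE mulrDl mulXn map_polyC hornerC -mulrA -exprD.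
exists (m.+1 + n)%N, ((a (Negz m))%:P * 'X^n + p * 'X^(m.+1)).
rewrite rmorphD hornerD !mulXn -pE mulrDl map_polyC hornerC NegzE -exprnN -mulrA.
by rewrite exprD mulKr // -exprD addnC exprD mulrA.
Qed.

End SkewLaurentDenominators.

(* An ideal of a subring spreads to an ideal of its localization at the powers  *)
(* of y.                                                                        *)
Lemma localized_ideal_central (R N : nzRingType) (phi : {rmorphism R -> N}) (y : R) :
  injective phi -> ideals_meet_center N ->
  (forall w, exists n r, phi (y ^+ n) * w = phi r) ->
  (forall w, exists n r, w * phi (y ^+ n) = phi r) ->
  (exists V, V * phi y = 1 /\ phi y * V = 1) ->
  forall (I : R -> Prop) r, two_sided_ideal I -> I r -> r <> 0 ->
  exists w n s, [/\ nonzero_central w, I s & phi s = w * phi (y ^+ n)].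
Proof.
move=> phi_inj meetN denl denr [V [VY YV]] I r idI Ir r0.
have VYn n : V ^+ n * phi (y ^+ n) = 1.
  by rewrite rmorphXn -exprMn_comm ?VY ?expr1n // /GRing.comm VY YV.
have YVn n : phi (y ^+ n) * V ^+ n = 1.
  by rewrite rmorphXn -exprMn_comm ?YV ?expr1n // /GRing.comm VY YV.
(* Powers of y are allowed on both sides. For a left factor v, write y^k (v w) y^n = (y^k v y^-m)
   (y^m w y^n), where k is chosen so that the first factor comes from [R]; right factors are
   symmetric. *)
pose J w := exists m n s, I s /\ phi (y ^+ m) * w * phi (y ^+ n) = phi s.
have idJ : two_sided_ideal J.
  split.
  - by exists 0%N, 0%N, 0; split; [exact: ideal_0 | rewrite mulr0 mul0r rmorph0].
  - move=> w w' [m [n [s [Is sE]]]] [m' [n' [s' [Is' s'E]]]].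
    exists (m' + m)%N, (n + n')%N, (y ^+ m' * s * y ^+ n' + y ^+ m * s' * y ^+ n); split.
      by apply: ideal_D => //; apply: ideal_Mr => //; apply: ideal_Ml.
    rewrite rmorphD !rmorphM /= -sE -s'E mulrDr mulrDl; congr (_ + _).
      by rewrite !exprD !rmorphM /= !mulrA.
    by rewrite addnC (addnC n) !exprD !rmorphM /= !mulrA.
  - move=> v w [m [n [s [Is sE]]]]; have [k [c cE]] := denl (v * V ^+ m).
    exists k, n, (c * s); split; first exact: ideal_Ml.
    by rewrite rmorphM -cE -sE !mulrA -[_ * V ^+ m * _]mulrA VYn mulr1.
  - move=> v w [m [n [s [Is sE]]]]; have [k [c cE]] := denr (V ^+ n * v).
    exists m, k, (s * c); split; first exact: ideal_Mr.
    by rewrite rmorphM -cE -sE !mulrA -[_ * phi (y ^+ n) * _]mulrA YVn mulr1.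
have [||w [m [n [s [Is sE]]]] [wC w0]] := meetN J (phi r) idJ.
- by exists 0%N, 0%N, r; rewrite expr0 rmorph1 mul1r mulr1.
- by rewrite -(rmorph0 phi) => /phi_inj.
by exists w, (m + n)%N, s; split=> //; rewrite -sE -wC -mulrA -rmorphM exprD.
Qed.

(** * The centre of R and the central multiples of powers of y in its ideals *)

Section AmbiskewCenter.
Variables (K : fieldType) (B : algType K) (alpha : {lrmorphism B -> B}).
Variables (SB : unitRingType) (iB : {rmorphism B -> SB}) (yB : SB).
Hypothesis SB_laurent : is_skew_laurent alpha iB yB.
Hypothesis SB_center : forall s : SB, central s <-> exists k : K, s = iB k%:A.
Variable t : nat.
Local Notation A := {mpoly B[t]}.
Local Notation M := {mpoly SB[t]}.
Local Notation N := {poly M}.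
Local Notation P := {poly {mpoly K[t]}}.

Definition scalM : {mpoly K[t]} -> M := map_mpoly iB \o map_mpoly (in_alg B).
HB.instance Definition _ := GRing.RMorphism.on scalM.

(** The copy of K[c_1, ..., c_t][z] in N; its image turns out to be the centre of N. *)
Definition scalN : P -> N := map_poly scalM.
HB.instance Definition _ := GRing.RMorphism.on scalN.

Lemma scalN_coef q k m : (scalN q)`_k@_m = iB (q`_k@_m)%:A.
Proof.
have -> : (scalN q)`_k = scalM q`_k by apply: coef_map.
by rewrite /scalM /= !mcoeff_map_mpoly.
Qed.

Lemma scalN_inj : injective scalN.
Proof.
have injK : injective (fun k : K => iB k%:A).
  move=> k l /(skew_laurent_inj SB_laurent)/eqP; rewrite -subr_eq0 -scalerBl.
  by rewrite scaler_eq0 oner_eq0 orbF subr_eq0 => /eqP.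
move=> p q pq; apply/polyP => k; apply/mpolyP => m; apply: injK.
by rewrite /= -!scalN_coef pq.
Qed.

Lemma scalN_central q : central (scalN q).
Proof.
apply: central_poly => c; apply/polyP => k; rewrite coefMC coefCM.
move: c; apply: central_mpoly => c; apply/mpolyP => m; rewrite mcoeffMC mcoeffCM.
rewrite scalN_coef.
have /SB_center : exists l : K, iB (q`_k@_m)%:A = iB l%:A by exists q`_k@_m.
exact.
Qed.

(** Coefficientwise, the hypotheses say that every coefficient of [f] is central in [SB], hence a
    scalar. Asking for commutation with B and y only makes this apply to [phi r] for [r] central in
    [R], which is known to commute only with the image of [R]. *)
Lemma central_scalN (f : N) :
  (forall b, f * (iB b)%:MP%:P = (iB b)%:MP%:P * f) ->
  f * yB%:MP%:P = yB%:MP%:P * f -> exists q, f = scalN q.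
Proof.
move=> fB fy; apply: map_poly_lift => k.
have [m|q ->] := map_mpoly_lift (f := iB \o in_alg B) (p := f`_k).
  apply/SB_center/(skew_laurent_central SB_laurent) => [b|].
    have := congr1 (fun g : N => g`_k@_m) (fB b).
    by rewrite coefMC coefCM mcoeffMC mcoeffCM.
  have := congr1 (fun g : N => g`_k@_m) fy.
  by rewrite coefMC coefCM mcoeffMC mcoeffCM.
by exists q; apply/mpolyP => m; rewrite /scalM /= !mcoeff_map_mpoly.
Qed.

Variables (R : nzRingType) (iR : {rmorphism A -> R}) (y z : R).
Variable phi : {rmorphism R -> N}.
Hypothesis phi_inj : injective phi.
Hypothesis phii : forall a, phi (iR a) = (map_mpoly iB a)%:P.
Hypothesis phiy : phi y = (yB%:MP)%:P.
Hypothesis phiz : phi z = 'X.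

Lemma casimir_comm a : z * iR a = iR a * z.
Proof. by apply: phi_inj; rewrite !rmorphM phiz phii commr_polyX. Qed.

Definition scalR : {mpoly K[t]} -> R := iR \o map_mpoly (in_alg B).
HB.instance Definition _ := GRing.RMorphism.on scalR.

Definition casimir_eval (q : P) : R := (map_poly scalR q).[z].

Lemma phi_casimir_eval q : phi (casimir_eval q) = scalN q.
Proof.
rewrite /casimir_eval; elim/poly_ind: q => [|q c IHq].
  by rewrite !rmorph0 horner0 rmorph0.
rewrite !rmorphD !rmorphM /= !map_polyX !map_polyC /=.
rewrite hornerD hornerMX hornerC !rmorphD !rmorphM /= phii phiz IHq.
by rewrite /scalN map_polyX map_polyC.
Qed.

Lemma eval_wc_casimir p : eval_wc iR z p = casimir_eval (split_var p).
Proof. by rewrite eval_wcE // => q; apply: casimir_comm. Qed.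

Lemma casimir_eval_central q : central (casimir_eval q).
Proof.
by move=> s; apply: phi_inj; rewrite !rmorphM /= phi_casimir_eval scalN_central.
Qed.

Lemma casimir_eval_inj : injective casimir_eval.
Proof.
move=> p q pq; apply: scalN_inj.
exact: etrans (esym (phi_casimir_eval p)) (etrans (congr1 phi pq) (phi_casimir_eval q)).
Qed.

Lemma casimir_eval0 : casimir_eval 0 = 0.
Proof. by rewrite /casimir_eval rmorph0 horner0. Qed.

Lemma casimir_evalM p q : casimir_eval (p * q) = casimir_eval p * casimir_eval q.
Proof. by apply: phi_inj; rewrite rmorphM /= !phi_casimir_eval rmorphM. Qed.

Lemma central_casimir_eval r : central r -> exists q, r = casimir_eval q.
Proof.
move=> rC; have [b||q qE] := @central_scalN (phi r).
- by rewrite -map_mpolyC -phii -!rmorphM rC.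
- by rewrite -phiy -!rmorphM rC.
by exists q; apply: phi_inj; rewrite phi_casimir_eval.
Qed.

Lemma ambiskew_center r : central r <-> exists p, r = eval_wc iR z p.
Proof.
split=> [/central_casimir_eval[q ->]|[p ->]]; last first.
  by rewrite eval_wc_casimir; apply: casimir_eval_central.
have [F EF FE] := split_var_bij K t.
by exists (F q); rewrite eval_wc_casimir FE.
Qed.

Lemma eval_wc_inj : injective (fun p => eval_wc iR z p).
Proof.
move=> p q pq; apply: (bij_inj (split_var_bij K t)); apply: casimir_eval_inj.
exact: etrans (esym (eval_wc_casimir p)) (etrans pq (eval_wc_casimir q)).
Qed.

Local Notation Y := (yB%:MP%:P : N).

Let phiyn n : phi (y ^+ n) = Y ^+ n. Proof. by rewrite rmorphXn /= phiy. Qed.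

Let YnC n c : Y ^+ n * c%:MP%:P = (yB ^+ n * c)%:MP%:P.
Proof. by rewrite mpolyCM polyCM !rmorphXn. Qed.

Let CYn n c : c%:MP%:P * Y ^+ n = (c * yB ^+ n)%:MP%:P.
Proof. by rewrite mpolyCM polyCM !rmorphXn. Qed.

Let phi_SB (p : {poly B}) : exists r, (map_poly iB p).[yB]%:MP%:P = phi r.
Proof.
elim/poly_ind: p => [|p c [r rE]].
  by exists 0; rewrite !rmorph0 horner0 mpolyC0 polyC0.
exists (r * y + iR c%:MP); rewrite rmorphD rmorphM /= map_polyX map_polyC.
rewrite hornerD hornerMX hornerC mpolyCD polyCD mpolyCM polyCM rE.
by rewrite rmorphD rmorphM /= phiy phii map_mpolyC.
Qed.

Let denominator_add (w w' : N) n n' r r' : Y ^+ n * w = phi r -> Y ^+ n' * w' = phi r' ->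
  Y ^+ (n + n') * (w + w') = phi (y ^+ n' * r + y ^+ n * r').
Proof.
by move=> wE w'E; rewrite rmorphD !rmorphM /= !phiyn -wE -w'E !mulrA -!exprD mulrDr addnC.
Qed.

(** z and the monomials in the c_j come from [R] and can be kept on the right, so only the
    denominators of constants from [SB] have to be cleared. *)
Lemma left_denominator (w : N) : exists n r, Y ^+ n * w = phi r.
Proof.
have mulR (v : N) s : (exists n r, Y ^+ n * v = phi r) ->
    exists n r, Y ^+ n * (v * phi s) = phi r.
  by move=> [n [r vE]]; exists n, (r * s); rewrite mulrA vE rmorphM.
have addR (v v' : N) : (exists n r, Y ^+ n * v = phi r) ->
    (exists n r, Y ^+ n * v' = phi r) -> exists n r, Y ^+ n * (v + v') = phi r.
  move=> [n [r vE]] [n' [r' v'E]]; exists (n + n')%N, (y ^+ n' * r + y ^+ n * r').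
  exact: denominator_add.
have zeroR : exists n r, Y ^+ n * 0 = phi r by exists 0%N, 0; rewrite mulr0 rmorph0.
have constR (c : SB) : exists n r, Y ^+ n * c%:MP%:P = phi r.
  have [n [p pE]] := skew_laurent_left_denominator SB_laurent c.
  by have [r rE] := phi_SB p; exists n, r; rewrite YnC pE.
elim/poly_ind: w => [//|w m IHw]; apply: (addR); first by rewrite -phiz; apply: mulR.
rewrite (mpolyE m); elim/big_rec: _ => [|k v _ IH]; first by rewrite polyC0.
rewrite polyCD; apply: (addR); last exact: IH.
rewrite -mul_mpolyC polyCM.
have -> : 'X_[k]%:P = phi (iR 'X_[k]) by rewrite phii map_mpolyX.
exact/mulR/constR.
Qed.

Lemma right_denominator (w : N) : exists n r, w * Y ^+ n = phi r.
Proof.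
have mulR (v : N) s : (exists n r, v * Y ^+ n = phi r) ->
    exists n r, phi s * v * Y ^+ n = phi r.
  by move=> [n [r vE]]; exists n, (s * r); rewrite -mulrA vE rmorphM.
have addR (v v' : N) : (exists n r, v * Y ^+ n = phi r) ->
    (exists n r, v' * Y ^+ n = phi r) -> exists n r, (v + v') * Y ^+ n = phi r.
  move=> [n [r vE]] [n' [r' v'E]]; exists (n + n')%N, (r * y ^+ n' + r' * y ^+ n).
  rewrite rmorphD !rmorphM /= !phiyn -vE -v'E -!mulrA -!exprD mulrDl.
  by rewrite [in RHS](addnC n').
have zeroR : exists n r, 0 * Y ^+ n = phi r by exists 0%N, 0; rewrite mul0r rmorph0.
have constR (c : SB) : exists n r, c%:MP%:P * Y ^+ n = phi r.
  have [n [p pE]] := skew_laurent_right_denominator SB_laurent c.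
  by have [r rE] := phi_SB p; exists n, r; rewrite CYn pE.
elim/poly_ind: w => [//|w m IHw]; apply: (addR).
  by rewrite commr_polyX -phiz; apply: mulR.
rewrite (mpolyE m); elim/big_rec: _ => [|k v _ IH]; first by rewrite polyC0.
rewrite polyCD; apply: (addR); last exact: IH.
rewrite -mul_mpolyC commr_mpolyX polyCM.
have -> : 'X_[k]%:P = phi (iR 'X_[k]) by rewrite phii map_mpolyX.
exact/mulR/constR.
Qed.

Hypothesis SB_simple : simple_ring SB.

(** The ideal spread to N contains a nonzero central element, which is some [scalN q]; returning to
    [R] costs a power of y. *)
Lemma ideal_casimir_power (I : R -> Prop) r : two_sided_ideal I -> I r -> r <> 0 ->
  exists q n, q <> 0 /\ I (casimir_eval q * y ^+ n).
Proof.
move=> idI Ir r0.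
have meetN := poly_ideals_meet_center (mpoly_ideals_meet_center (n := t) SB_simple).
have denl w : exists n r, phi (y ^+ n) * w = phi r.
  by have [n [c cE]] := left_denominator w; exists n, c; rewrite phiyn.
have denr w : exists n r, w * phi (y ^+ n) = phi r.
  by have [n [c cE]] := right_denominator w; exists n, c; rewrite phiyn.
have invY : exists V, V * phi y = 1 /\ phi y * V = 1.
  have UB := skew_laurent_unit SB_laurent.
  by exists yB^-1%:MP%:P; rewrite phiy; split; rewrite -polyCM -mpolyCM ?mulVr ?divrr.
have [w [n [s [[wC w0] Is sE]]]] :=
  localized_ideal_central phi_inj meetN denl denr invY idI Ir r0.
have [q qE] := central_scalN (fun b => wC _) (wC _).
exists q, n; split; first by move=> q0; apply: w0; rewrite qE q0 rmorph0.
suff -> : casimir_eval q * y ^+ n = s by [].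
by apply: phi_inj; rewrite rmorphM sE qE /= phi_casimir_eval.
Qed.

(* The annihilator of a central element of N is an ideal, so it would otherwise *)
(* contain a nonzero element of the centre, which is a domain.                  *)
Lemma nonzero_central_regular (r s : R) : nonzero_central s -> r * s = 0 -> r = 0.
Proof.
move=> [/central_casimir_eval[q ->] q0] rq0.
have meetN := poly_ideals_meet_center (mpoly_ideals_meet_center (n := t) SB_simple).
pose J w := w * scalN q = 0.
have idJ : two_sided_ideal J.
  split=> [|a b a0 b0|a b b0|a b b0]; rewrite /J; first by rewrite mul0r.
  - by rewrite mulrDl a0 b0 addr0.
  - by rewrite -mulrA b0 mulr0.
  - by rewrite -mulrA -scalN_central mulrA b0 mul0r.
have Jr : J (phi r) by rewrite /J -phi_casimir_eval -rmorphM rq0 rmorph0.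
apply: NNPP => r0; have [|w Jw [wC w0]] := meetN J (phi r) idJ Jr.
  by move=> pr0; apply: r0; apply: phi_inj; rewrite pr0 rmorph0.
have [p pE] := central_scalN (fun b => wC _) (wC _).
have pqE : scalN (p * q) = scalN 0 by rewrite rmorphM rmorph0 /= -pE.
have /eqP := scalN_inj pqE; rewrite mulf_eq0 => /orP[]/eqP pq.
  by apply: w0; rewrite pE pq rmorph0.
by apply: q0; rewrite pq casimir_eval0.
Qed.

End AmbiskewCenter.

(** * Descent on the power of y *)

(** A factor theorem for two commuting points of a noncommutative ring. At the points u and -z it
    makes p(u, c) and p(-z, c) congruent modulo z + u. *)
Lemma horner_map_sub (C S : nzRingType) (g : {rmorphism C -> S}) (w w' : S)
  (f : {poly C}) :
  w * w' = w' * w ->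
  exists H, (map_poly g f).[w] - (map_poly g f).[w'] = H * (w - w').
Proof.
move=> ww'; elim/poly_ind: f => [|f c [H HE]].
  by exists 0; rewrite rmorph0 !horner0 subrr mul0r.
exists (H * w + (map_poly g f).[w']).
rewrite rmorphD rmorphM /= map_polyX map_polyC !hornerD !hornerMX !hornerC.
have wB : w * (w - w') = (w - w') * w by rewrite mulrBr mulrBl ww'.
rewrite opprD addrACA subrr addr0 mulrDl -(mulrA H) wB mulrA -HE.
by rewrite mulrBl mulrBr addrA subrK.
Qed.

Lemma horner_map_compN (C S : nzRingType) (g : {rmorphism C -> S}) (w : S)
  (f : {poly C}) :
  (map_poly g (f \Po (- 'X))).[w] = (map_poly g f).[- w].
Proof.
elim/poly_ind: f => [|f c IHf]; first by rewrite comp_poly0 rmorph0 !horner0.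
rewrite comp_poly_MXaddC !rmorphD !rmorphM /= rmorphN /= !map_polyX !map_polyC.
by rewrite !hornerD !hornerMX !hornerC mulrN hornerN hornerMX IHf mulrN.
Qed.

Section Descent.
Variables (A R : nzRingType) (s : {rmorphism A -> A}) (iR : {rmorphism A -> R}).
Variables (x y z : R) (u : A).
Hypothesis ya : forall a, y * iR a = iR (s a) * y.
Hypothesis xyE : x * y = z + iR u.
Hypothesis yxE : y * x = z + iR (s u).
Hypothesis yz : y * z = z * y.

Lemma casimir_power_x n : y ^+ n.+1 * x = (z + iR (iter n.+1 s u)) * y ^+ n.
Proof.
elim: n => [|n IHn]; first by rewrite expr1 yxE expr0 mulr1.
rewrite exprS -mulrA IHn mulrA mulrDr yz ya -mulrDl -mulrA -exprS //.
Qed.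

(** Applied with d = q(z, c), e = p(-z, c) and a v^(n+1) = p(u, c). Both d (z + u) y^n and d (z +
    alpha^(n+1)(u)) y^n lie in the ideal; [a] times their difference, corrected by [H] times the
    first, is d e y^n. *)
Lemma ideal_descent (I : R -> Prop) d n a e H :
  two_sided_ideal I -> central d -> I (d * y ^+ n.+1) ->
  iR (a * (u - iter n.+1 s u)) - e = H * (z + iR u) -> I (d * e * y ^+ n).
Proof.
move=> idI dC Idy eE.
have I1 : I (d * ((z + iR u) * y ^+ n)).
  by rewrite -xyE -mulrA -exprS mulrA dC -mulrA; apply: ideal_Ml.
have I2 : I (d * ((z + iR (iter n.+1 s u)) * y ^+ n)).
  by rewrite -casimir_power_x mulrA; apply: ideal_Mr.
have -> : d * e * y ^+ n = iR a * (d * ((z + iR u) * y ^+ n)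
    - d * ((z + iR (iter n.+1 s u)) * y ^+ n)) - H * (d * ((z + iR u) * y ^+ n)).
  have dM b c : b * (d * (c * y ^+ n)) = d * (b * c) * y ^+ n.
    by rewrite !mulrA -(dC b).
  rewrite -mulrBr -mulrBl opprD addrACA subrr add0r -rmorphB !dM -rmorphM -eE.
  by rewrite -mulrBl -mulrBr opprB addrC subrK.
by apply: ideal_B => //; apply: ideal_Ml => //; apply: ideal_B.
Qed.

End Descent.

(** * Iterates of alpha and the Verma module *)

Section IterMorphism.
Variables (A : nzRingType) (s : {rmorphism A -> A}).

Lemma iter_morphD k (a b : A) : iter k s (a + b) = iter k s a + iter k s b.
Proof. by elim: k => //= k IHk; rewrite IHk rmorphD. Qed.

Lemma iter_morphM k (a b : A) : iter k s (a * b) = iter k s a * iter k s b.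
Proof. by elim: k => //= k IHk; rewrite IHk rmorphM. Qed.

Lemma iter_morph1 k : iter k s 1 = 1.
Proof. by elim: k => //= k ->; rewrite rmorph1. Qed.

Lemma iter_morphB k (a b : A) : iter k s (a - b) = iter k s a - iter k s b.
Proof. by elim: k => //= k IHk; rewrite IHk rmorphB. Qed.

Lemma iter_morph_central k u :
  (forall a, exists a', s a' = a) -> central u -> central (iter k s u).
Proof.
move=> s_surj uC; elim: k => //= k IHk a.
by have [a' <-] := s_surj a; rewrite -!rmorphM IHk.
Qed.

End IterMorphism.

(* The Verma module on which x is injective: it has a basis e_k = x^k e_0 over   *)
(* A with y e_0 = 0, z acts on it as -u, and y e_m is the multiple               *)
(* alpha^m(u) - u of e_(m-1).                                                    *)
Section Verma.
Variables (A R : nzRingType) (s : {rmorphism A -> A}) (iR : {rmorphism A -> R}).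
Variables (x y : R) (u : A).
Hypothesis s_surj : forall a, exists a', s a' = a.
Hypothesis u_central : central u.
Hypothesis ambiR : is_ambiskew s (u - s u) iR x y.

(** A polynomial f stands for the vector \sum_k x^k f_k e_0, with coordinates to the right of the
    powers of x; the twist comes from a x^k = x^k alpha^k(a). *)
Definition verma_scale (a : A) (f : {poly A}) : {poly A} :=
  \poly_(k < size f) (iter k s a * f`_k).

(** The factor comes from y x^(k+1) = x^k (z + alpha^(k+1)(u)), with z acting as -u. *)
Definition verma_y (f : {poly A}) : {poly A} :=
  \poly_(k < size f) ((iter k.+1 s u - u) * f`_k.+1).

Lemma coef_verma_scale a f k : (verma_scale a f)`_k = iter k s a * f`_k.
Proof. by rewrite coef_poly; case: ltnP => // kf; rewrite nth_default ?mulr0. Qed.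

Lemma coef_verma_y f k : (verma_y f)`_k = (iter k.+1 s u - u) * f`_k.+1.
Proof.
by rewrite coef_poly; case: ltnP => // kf; rewrite nth_default ?mulr0 // leqW.
Qed.

Lemma verma_action : exists rho : R -> {poly A} -> {poly A},
  [/\ is_action rho, forall a f, rho (iR a) f = verma_scale a f,
      forall f, rho x f = f * 'X & forall f, rho y f = verma_y f].
Proof.
have uk k : central (iter k s u) by apply: iter_morph_central.
apply: (ambiskew_action ambiR s_surj).
- split=> [a b f|a f g|a b f|f]; apply/polyP => k; rewrite ?coefD !coef_verma_scale.
  + by rewrite iter_morphD mulrDl.
  + by rewrite coefD mulrDr.
  + by rewrite iter_morphM mulrA.
  + by rewrite iter_morph1 mul1r.
- by move=> f g; rewrite mulrDl.
- by move=> f g; apply/polyP => k; rewrite coefD !coef_verma_y coefD mulrDr.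
- move=> a f; apply/polyP => k.
  rewrite coef_verma_y !coef_verma_scale coef_verma_y !mulrA -iterSr.
  by congr (_ * _); rewrite mulrBl mulrBr uk u_central.
- move=> a f; apply/polyP => -[|k]; rewrite !coef_verma_scale !coefMX ?mulr0 //=.
  by rewrite coef_verma_scale -iterSr.
- move=> f; apply/polyP => k;
  rewrite coefD coefMX !coef_verma_y coef_verma_scale coefMX /=.
  rewrite iter_morphB -iterSr -mulrDl /= [X in X * f`_k]addrC subrKA.
  by case: k => [|k]; rewrite /= ?subrr ?mul0r.
Qed.

Variable rho : R -> {poly A} -> {poly A}.
Hypotheses (rhoR : is_action rho) (rhoi : forall a f, rho (iR a) f = verma_scale a f)
  (rhox : forall f, rho x f = f * 'X) (rhoy : forall f, rho y f = verma_y f).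
Variable m : nat.
Let v := u - iter m s u.

Let vC : central v.
Proof.
by move=> a; rewrite mulrBl mulrBr u_central (iter_morph_central _ s_surj u_central).
Qed.

Definition verma_sub (f : {poly A}) : Prop :=
  forall k, (k < m)%N -> exists c, f`_k = v * c.

Lemma verma_sub0 : verma_sub 0.
Proof. by move=> k _; exists 0; rewrite coef0 mulr0. Qed.

Lemma verma_subD f g : verma_sub f -> verma_sub g -> verma_sub (f + g).
Proof.
move=> Wf Wg k km; have [c cE] := Wf k km; have [d dE] := Wg k km.
by exists (c + d); rewrite coefD cE dE mulrDr.
Qed.

Lemma verma_sub_stable r f : verma_sub f -> verma_sub (rho r f).
Proof.
move: r f; apply: (ambiskew_ind ambiR) => [a|||r r' IH IH'|r r' IH IH'] f Wf.
- move=> k km; have [c cE] := Wf k km; exists (iter k s a * c).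
  by rewrite rhoi coef_verma_scale cE mulrA -vC -mulrA.
- case=> [|k] km; first by exists 0; rewrite rhox coefMX mulr0.
  by have [c cE] := Wf k (ltnW km); exists c; rewrite rhox coefMX.
- move=> k km; rewrite rhoy coef_verma_y; case: (ltngtP k.+1 m) => [km'||km'].
  + have [c ->] := Wf _ km'; exists ((iter k.+1 s u - u) * c).
    by rewrite mulrA -vC -mulrA.
  + by rewrite ltnNge km.
  (* At the boundary k+1 = m the factor alpha^m(u) - u is -v, so the unconstrained coordinate m
     enters coordinate m-1 as a multiple of v. *)
  + by exists (- f`_k.+1); rewrite km' /v mulrN -mulNr opprB.
- by rewrite (actDl rhoR); apply: verma_subD; [apply: IH|apply: IH'].
- by rewrite (actM rhoR); apply: IH; apply: IH'.
Qed.

Definition verma_ideal (r : R) : Prop := forall f, verma_sub (rho r f).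

Lemma verma_idealP : two_sided_ideal verma_ideal.
Proof.
split.
- by move=> f; rewrite act0l //; apply: verma_sub0.
- by move=> a b Ia Ib f; rewrite (actDl rhoR); apply: verma_subD.
- by move=> r a Ia f; rewrite (actM rhoR); apply: verma_sub_stable.
- by move=> r a Ia f; rewrite (actM rhoR).
Qed.

Lemma verma_ideal_power : verma_ideal (y ^+ m).
Proof.
(* Coordinate k of y^j f comes from coordinate k+j of f. If k < m <= k+j, the way down crosses from
   m to m-1, where the factor -v appears. *)
have main j f k : (k < m)%N -> (m <= k + j)%N -> exists c, (rho (y ^+ j) f)`_k = v * c.
  elim: j k => [|j IHj] k km mkj; first by rewrite addn0 leqNgt km in mkj.
  rewrite exprS (actM rhoR) rhoy coef_verma_y; case: (ltngtP k.+1 m) => [km'||km'].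
  - have [|c ->] := IHj k.+1 km'; first by rewrite addSnnS.
    by exists ((iter k.+1 s u - u) * c); rewrite mulrA -vC -mulrA.
  - by rewrite ltnNge km.
  - by eexists; rewrite km' -(opprB u) mulNr -mulrN.
by move=> f k km; apply: main; rewrite // leq_addl.
Qed.

(** Images under x have zero coordinate 0, so z = x y - u acts on coordinate 0 as -u. Applying q(z,
    c) to e_0, which is the polynomial 1, gives q(-u, c) there, and this coordinate is constrained
    because m > 0. *)
Lemma verma_ideal_casimir (C : nzRingType) (g : {rmorphism C -> A}) (q : {poly C}) :
  (0 < m)%N -> verma_ideal (map_poly (iR \o g) q).[x * y - iR u] ->
  exists c, (map_poly g q).[- u] = v * c.
Proof.
set z := x * y - iR u => m_gt0 Iq.
have rhoN r f : rho (- r) f = - rho r f.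
  by apply: (addIr (rho r f)); rewrite -(actDl rhoR) !addNr act0l.
have rhoz f : (rho z f)`_0 = - u * f`_0.
  rewrite (actDl rhoR) rhoN (actM rhoR) rhox rhoi coefD coefN coefMX coef_verma_scale.
  by rewrite add0r mulNr.
suff evE f : (rho (map_poly (iR \o g) q).[z] f)`_0 = (map_poly g q).[- u] * f`_0.
  by have [c cE] := Iq 1 0%N m_gt0; exists c; rewrite -cE evE coef1 mulr1.
elim/poly_ind: q f {Iq} => [|q c IHq] f.
  by rewrite !rmorph0 !horner0 act0l // coef0 mul0r.
rewrite !rmorphD !rmorphM /= !map_polyX !map_polyC !hornerD !hornerMX !hornerC.
rewrite (actDl rhoR) (actM rhoR) coefD IHq rhoz rhoi coef_verma_scale /=.
by rewrite mulrDl mulrA.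
Qed.

End Verma.

(** * Simplicity of the central localization *)

Section CentralLocalization.
Variables (R : nzRingType) (L : unitRingType) (f : {rmorphism R -> L}).
Hypothesis locL : is_localization (@nonzero_central R) f.
Hypothesis regular : forall r s : R, nonzero_central s -> r * s = 0 -> r = 0.

Lemma loc_central s : central s -> central (f s).
Proof.
move=> sC l; have [r [w [Zw ->]]] := loc_frac locL l.
have com w' : GRing.comm (f s) (f w') by rewrite /GRing.comm -!rmorphM sC.
by apply: commrM => //; apply: commrV.
Qed.

Lemma loc_inj0 r : f r = 0 -> r = 0.
Proof. by move=> /(loc_ker locL)[s Zs]; apply: regular. Qed.

Lemma nonzero_centralM (r s : R) : nonzero_central r -> nonzero_central s ->
  nonzero_central (r * s).
Proof.
move=> [rC r0] Zs; split; last by move=> /(regular Zs).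
by move=> w; rewrite -mulrA (Zs.1 w) mulrA rC -mulrA.
Qed.

(** Ideals of [L] are contracted to [R], and a nonzero central element of the contraction becomes a
    unit. Conversely an ideal of [R] is extended to the fractions with numerator in it; if the
    extension contains 1 = r/s, then r = s is central and lies in the ideal. *)
Lemma localization_simple : simple_ring L <-> ideals_meet_center R.
Proof.
split=> [simpleL I a idI Ia a0|meetR J idJ]; last first.
  have [[l Jl l0]|J0] := classic (exists2 l, J l & l <> 0); last first.
    by left=> l Jl; apply: NNPP => l0; apply: J0; exists l.
  right; have [r [s [Zs lE]]] := loc_frac locL l.
  have Us := loc_unit locL Zs.
  have Jr : J (f r) by rewrite (_ : f r = l * f s); [apply: ideal_Mr|rewrite lE divrK].
  pose I w := J (f w).
  have idI : two_sided_ideal I.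
    split=> [|a b Ja Jb|a b Jb|a b Jb]; rewrite /I ?rmorph0 ?rmorphD ?rmorphM.
    - exact: ideal_0.
    - exact: ideal_D.
    - exact: ideal_Ml.
    - exact: ideal_Mr.
  have [|c Ic Zc] := meetR I r idI Jr; first by move=> r0; apply: l0;
    rewrite lE r0 rmorph0 mul0r.
  by move=> w; rewrite -(divrK (loc_unit locL Zc) w); apply: ideal_Ml.
pose J l := exists r s, [/\ I r, nonzero_central s & l = f r / f s].
have Z1 : nonzero_central (1 : R).
  by split=> [w|/eqP]; rewrite ?mulr1 ?mul1r ?oner_eq0.
have divC (s : R) l : central s -> (f s)^-1 * l = l * (f s)^-1.
  by move=> sC; apply/esym/commrV/esym/loc_central.
have idJ : two_sided_ideal J.
  split.
  - by exists 0, 1; rewrite rmorph0 mul0r; split=> //; apply: ideal_0.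
  - move=> _ _ [r [s [Ir Zs ->]]] [r' [s' [Ir' Zs' ->]]].
    exists (r * s' + r' * s), (s * s'); split.
    + by apply: ideal_D => //; apply: ideal_Mr.
    + exact: nonzero_centralM.
    have Us := loc_unit locL Zs; have Us' := loc_unit locL Zs'.
    rewrite rmorphD !rmorphM invrM // mulrDl !mulrA mulrK //; congr (_ + _).
    by rewrite -!mulrA (divC s') ?mulVKr //; case: Zs'.
  - move=> l _ [r [s [Ir Zs ->]]]; have [r' [s' [Zs' ->]]] := loc_frac locL l.
    exists (r' * r), (s' * s); split; [exact: ideal_Ml|exact: nonzero_centralM|].
    have Us := loc_unit locL Zs; have Us' := loc_unit locL Zs'.
    by rewrite !rmorphM invrM // -!mulrA (divC s') ?mulrA //; case: Zs'.
  - move=> l _ [r [s [Ir Zs ->]]]; have [r' [s' [Zs' ->]]] := loc_frac locL l.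
    exists (r * r'), (s * s'); split; [exact: ideal_Mr|exact: nonzero_centralM|].
    have Us := loc_unit locL Zs; have Us' := loc_unit locL Zs'.
    by rewrite !rmorphM invrM // -!mulrA (divC s) ?mulrA //; case: Zs.
case: (simpleL J idJ) => [J0|Jall].
  case: a0; apply: loc_inj0; apply: J0; exists a, 1; split=> //.
  by rewrite rmorph1 divr1.
have [r [s [Ir Zs rs]]] := Jall 1; exists s => //.
have Us := loc_unit locL Zs.
suff -> : s = r by [].
apply/eqP; rewrite -subr_eq0; apply/eqP/loc_inj0.
by rewrite rmorphB -[f r](divrK Us) -rs mul1r subrr.
Qed.

End CentralLocalization.

(** * The centres and the simplicity criterion *)

Theorem proposition2p9 (K : closedFieldType) (B : algType K)
    (alpha : {lrmorphism B -> B}) (alpha_bij : bijective alpha)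
    (SB : unitRingType) (iB : {rmorphism B -> SB}) (yB : SB)
    (SB_laurent : is_skew_laurent alpha iB yB)
    (SB_simple : simple_ring SB)
    (SB_center : forall s : SB, central s <-> exists k : K, s = iB k%:A)
    (t : nat) (u : {mpoly B[t]}) (u_central : central u)
    (* SA = A[y^{+-1}; alpha] with A = B[c_1, ..., c_t] *)
    (SA : unitRingType) (iA : {rmorphism {mpoly B[t]} -> SA}) (yA : SA)
    (SA_laurent : is_skew_laurent (map_mpoly alpha) iA yA)
    (R : nzRingType) (iR : {rmorphism {mpoly B[t]} -> R}) (x y : R)
    (R_ambiskew : is_ambiskew (map_mpoly alpha) (u - map_mpoly alpha u) iR x y) :
  let z := x * y - iR u in
  ((forall s : SA, central s <->
      exists q : {mpoly K[t]}, s = iA (map_mpoly (in_alg B) q)) /\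
   (forall r : R, central r <-> exists q : {mpoly K[t.+1]}, r = eval_wc iR z q) /\
   injective (fun q : {mpoly K[t.+1]} => eval_wc iR z q)) /\
  (forall (L : unitRingType) (f : {rmorphism R -> L}),
     is_localization (@nonzero_central R) f ->
     (simple_ring L <->
      forall m : nat, (1 <= m)%N ->
        exists2 p : {mpoly K[t.+1]}, p != 0 &
          exists a : {mpoly B[t]},
            eval_wc idfun u p = (u - iter m (map_mpoly alpha) u) * a)).
Proof.
move=> z; have s_surj := map_mpoly_surj alpha_bij (t := t).
have SB_centerP : forall s, central s -> exists k : K, s = iB k%:A.
  by move=> s /SB_center.
have [phi [phi_inj phii phix phiy phiz]] :=
  ambiskew_embedding alpha_bij SB_laurent u_central R_ambiskew.
have [ya _ xyE] := ambiskew_rel R_ambiskew.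
have za := casimir_comm phi_inj phii phiz.
split; first split.
- exact: (laurent_center alpha_bij SB_laurent SB_centerP SA_laurent).
- split; first exact: (ambiskew_center SB_laurent SB_center phi_inj phii phiy phiz).
  exact: (eval_wc_inj SB_laurent phi_inj phii phiz).
have eval_u p : eval_wc idfun u p = (map_poly (map_mpoly (in_alg B)) (split_var p)).[u].
  by apply: (eval_wcE (i := idfun)) => q; rewrite u_central.
have [E' EK KE] := split_var_bij K t.
have regR := nonzero_central_regular SB_laurent SB_center phi_inj phii phiy phiz
  SB_simple.
(* Simplicity of [L] becomes a statement about the ideals of [R] alone. *)
move=> L f /(localization_simple)/(_ regR) ->;
  split=> [meetR m m_gt0|descent I r idI Ir r0].
  have [rho [rhoA rhoi rhox rhoy]] := verma_action s_surj u_central R_ambiskew.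
  have idV := verma_idealP s_surj u_central R_ambiskew rhoA rhoi rhox rhoy m.
  have Vy := verma_ideal_power s_surj u_central rhoA rhoy (m := m).
  have ym0 : y ^+ m <> 0.
    move=> /(congr1 phi)/eqP; rewrite rmorph0 rmorphXn /= phiy -!rmorphXn /=.
    rewrite polyC_eq0 mpolyC_eq0 => /eqP ym0.
    have := unitrX m (skew_laurent_unit SB_laurent).
    by rewrite ym0 unitr0.
  have [c Vc [cC c0]] := meetR _ _ idV Vy ym0.
  have [q qE] := central_casimir_eval SB_laurent SB_center phi_inj phii phiy phiz cC.
  have q0 : q != 0 by apply/eqP => q0; apply: c0; rewrite qE q0 casimir_eval0.
  rewrite qE in Vc.
  have [a aE] := verma_ideal_casimir (g := map_mpoly (in_alg B)) rhoA rhoi rhox m_gt0 Vc.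
  (* The Verma module yields q(-u, c) in v^(m) A, so p_m is q with X replaced by -X, a substitution
     that preserves the degree. *)
  exists (E' (q \Po - 'X)).
    by rewrite -split_var_eq0 KE -size_poly_eq0 size_comp_poly2 ?size_polyN ?size_polyX
      // size_poly_eq0.
  by exists a; rewrite eval_u KE horner_map_compN.
have [q [n [q0 Iq]]] :=
  ideal_casimir_power SB_laurent SB_center phi_inj phii phiy phiz SB_simple idI Ir r0.
have yxE : y * x = z + iR (map_mpoly alpha u).
  rewrite -[y * x](addrK (iR (u - map_mpoly alpha u))) -xyE rmorphB opprB.
  by rewrite [_ - iR u]addrC addrA.
have yz : y * z = z * y.
  by apply: phi_inj; rewrite !rmorphM /= phiz commr_polyX.
(* Each step trades one power of y for the nonzero factor p_(n+1)(-z, c) of q; at n = 0 the element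
   of the ideal is central. *)
elim: n q q0 Iq => [|n IHn] q q0 Iq.
  exists (casimir_eval iR z q); first by rewrite expr0 mulr1 in Iq.
  split; first exact: (casimir_eval_central SB_center phi_inj phii phiz).
  move=> ev0; apply: q0; have inj := casimir_eval_inj SB_laurent phii phiz.
  by apply: inj; rewrite ev0 casimir_eval0.
have [p p0 [a pE]] := descent n.+1 isT.
pose q' := split_var p \Po - 'X.
have zu : iR u * - z = - z * iR u by rewrite mulrN mulNr za.
have [H HE] := horner_map_sub (scalR iR) (split_var p) zu.
have q'0 : q' != 0.
  by rewrite -size_poly_eq0 size_comp_poly2 ?size_polyN ?size_polyX // size_poly_eq0
    split_var_eq0.
apply: (IHn (q * q')); first by apply/eqP; rewrite mulf_neq0 //; apply/eqP.
rewrite (casimir_evalM phi_inj phii phiz).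
have xyE' : x * y = z + iR u by rewrite subrK.
have dC := casimir_eval_central SB_center phi_inj phii phiz q.
apply: (ideal_descent ya xyE' yxE yz idI dC Iq (a := a) (H := H)).
have -> : z + iR u = iR u - - z by rewrite opprK addrC.
rewrite -HE; congr (_ - _); last exact: horner_map_compN.
have vC : central (u - iter n.+1 (map_mpoly alpha) u).
  by move=> b; rewrite mulrBl mulrBr u_central (iter_morph_central _ s_surj u_central).
by rewrite -vC -pE eval_u -horner_map -map_poly_comp.
Qed.
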